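(* Let $\alpha\ge1$ be an integer and let $b:\mathbb{D}\to\mathbb{D}$ be a non-constant analytic map. If $f\in A(b,\alpha)$, then the weighted composition operator $M_fC_b$ is bounded on $A^2_\alpha$ and $$\|M_fC_b\|\le\|f\|_{A(b,\alpha)}.$$ Moreover $C_b$ is bounded on $A^2_\alpha$, with $$\|C_b\|\le\left(\frac{1+|b(0)|}{1-|b(0)|}\right)^{\alpha/2},$$ and more generally $$\|C_b\|\le\inf_{f\in A(b,\alpha)}\left\{\|1/f\|_\infty\,\|f\|_{A(b,\alpha)}\right\}.$$
   Context: $\mathbb{D}$ is the open unit disk in $\mathbb{C}$. For $\alpha\ge1$, $A^2_\alpha$ is the reproducing kernel Hilbert space on $\mathbb{D}$ with kernel $$k^\alpha(z,w)=\frac{1}{(1-z\overline{w})^\alpha}.$$ For $\alpha=1$ this is the Hardy space $H^2$; for $\alpha>1$ it is the space of analytic functions on $\mathbb{D}$ with finite norm $\|f\|^2_{A^2_\alpha}=\frac{\alpha-1}{\pi}\int_{\mathbb{D}}|f(z)|^2(1-|z|^2)^{\alpha-2}\,dA(z)$, where $dA$ is planar Lebesgue measure. For an integer $\alpha\ge1$, $A(b,\alpha)$ is the reproducing kernel Hilbert space on $\mathbb{D}$ with the (positive semidefinite) kernel $$k^{b,\alpha}(z,w)=\left(\frac{1-b(z)\overline{b(w)}}{1-z\overline{w}}\right)^\alpha.$$ $C_b$ is the composition operator $(C_bg)(z)=g(b(z))$, $M_f$ is multiplication by $f$, so $(M_fC_bg)(z)=f(z)g(b(z))$. $\|1/f\|_\infty$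 is the supremum of $|1/f|$ over $\mathbb{D}$; the product $\|1/f\|_\infty\|f\|_{A(b,\alpha)}$ is understood to be $+\infty$ when $1/f$ is not a bounded function on $\mathbb{D}$ (in particular if $f$ has a zero). *)

(* Defs.v *)
(* Stdlib world: classical reals, with Coquelicot's complex numbers. *)
From Stdlib Require Import Reals.
From Coquelicot Require Import Coquelicot.
Open Scope R_scope.

Definition disk : Type := {z : C | Cmod z < 1}.

Definition disk_val (z : disk) : C := proj1_sig z.
Coercion disk_val : disk >-> C.

Lemma Cmod_zero_lt_1 : Cmod (RtoC 0) < 1.
Proof. rewrite Cmod_0. exact Rlt_0_1. Qed.

Definition disk0 : disk := exist _ (RtoC 0) Cmod_zero_lt_1.

(* Differentiability is a local notion and the disk is open, so the values of
   the extension [F] outside the disk are irrelevant. *)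
Definition analytic_on_disk (f : disk -> C) : Prop :=
  exists F : C -> C,
    (forall z : disk, F (disk_val z) = f z) /\
    (forall z : disk, ex_derive (K := C_AbsRing) (V := C_NormedModule) F (disk_val z)).

Definition norm_of {X : Type} (ip : (X -> C) -> (X -> C) -> C) (f : X -> C) : R :=
  sqrt (Re (ip f f)).

(* A Hilbert space of functions on [X] with reproducing kernel [k].  Only the
   values of [inner] on members of the space matter.  By Moore-Aronszajn the
   space and its inner product are determined by [k]. *)
Record RKHS {X : Type} (k : X -> X -> C) : Type := {
  carrier : (X -> C) -> Prop;
  inner : (X -> C) -> (X -> C) -> C;
  carrier_zero : carrier (fun _ => RtoC 0);
  carrier_plus : forall f g, carrier f -> carrier g ->
    carrier (fun x => f x + g x)%C;
  carrier_scal : forall (c : C) f, carrier f -> carrier (fun x => c * f x)%C;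
  inner_plus : forall f g h, carrier f -> carrier g -> carrier h ->
    inner (fun x => f x + g x)%C h = (inner f h + inner g h)%C;
  inner_scal : forall (c : C) f h, carrier f -> carrier h ->
    inner (fun x => c * f x)%C h = (c * inner f h)%C;
  inner_conj : forall f g, carrier f -> carrier g ->
    inner g f = Cconj (inner f g);
  inner_nonneg : forall f, carrier f -> 0 <= Re (inner f f);
  inner_definite : forall f, carrier f -> inner f f = RtoC 0 ->
    forall x, f x = RtoC 0;
  carrier_complete : forall u : nat -> X -> C,
    (forall n, carrier (u n)) ->
    (forall eps : R, 0 < eps -> exists N : nat, forall n m : nat,
       (N <= n)%nat -> (N <= m)%nat ->
       norm_of inner (fun x => u n x - u m x)%C < eps) ->
    exists l : X -> C, carrier l /\
      is_lim_seq (fun n => norm_of inner (fun x => u n x - l x)%C) 0;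
  kernel_in : forall w, carrier (fun z => k z w);
  reproducing : forall f w, carrier f -> inner f (fun z => k z w) = f w
}.

Arguments carrier {X k} _ _.
Arguments inner {X k} _ _ _.

Definition hnorm {X : Type} {k : X -> X -> C} (H : RKHS k) (f : X -> C) : R :=
  norm_of (inner H) f.

Definition bounded_on {X : Type} {k : X -> X -> C} (H : RKHS k)
    (T : (X -> C) -> (X -> C)) : Prop :=
  (forall g, carrier H g -> carrier H (T g)) /\
  exists M : R, forall g, carrier H g -> hnorm H (T g) <= M * hnorm H g.

Definition op_norm {X : Type} {k : X -> X -> C} (H : RKHS k)
    (T : (X -> C) -> (X -> C)) : Rbar :=
  Lub_Rbar (fun r : R =>
    exists g, carrier H g /\ hnorm H g <= 1 /\ r = hnorm H (T g)).

Definition bergman_kernel (alpha : nat) (z w : disk) : C :=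
  (1 / (1 - z * Cconj w) ^ alpha)%C.

Definition sub_bergman_kernel (b : disk -> disk) (alpha : nat) (z w : disk) : C :=
  (((1 - b z * Cconj (b w)) / (1 - z * Cconj w)) ^ alpha)%C.

Definition comp_op (b : disk -> disk) (g : disk -> C) : disk -> C :=
  fun z => g (b z).

Definition mult_op (f : disk -> C) (g : disk -> C) : disk -> C :=
  fun z => (f z * g z)%C.

(* [/ 0 = 0] in the library, so the value of |1/f| at a zero of f is set to
   [p_infty] explicitly. *)
Definition sup_inv (f : disk -> C) : Rbar :=
  Rbar_lub (fun r : Rbar => exists z : disk,
    (f z = RtoC 0 /\ r = p_infty) \/
    (f z <> RtoC 0 /\ r = Finite (Cmod (1 / f z)%C))).

(* [Rbar_mult p_infty 0 = 0], whereas this product is +oo whenever 1/f is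
   unbounded, also for f = 0. *)
Definition sup_inv_times (f : disk -> C) (c : R) : Rbar :=
  match sup_inv f with
  | Finite s => Finite (s * c)
  | _ => p_infty
  end.

(* Main.v *)
Require Import Defs.
From Stdlib Require Import Reals Lra Lia List ClassicalEpsilon FunctionalExtensionality.
From Coquelicot Require Import Coquelicot.
Open Scope R_scope.

(** Everything is reduced to positivity of kernels.  A tilde denotes complex
    conjugation, and u u~ stands for the kernel u(z) conj(u(w)).  Write k for the
    kernel of A^2_alpha and k^b for that of A(b, alpha); then
    k^b(z,w) k(b z, b w) = k(z,w).

    The operator T : g |-> f (g o b) has a formal adjoint that sends k(., w) to
    conj (f w) k(., b w).  So T maps a reproducing kernel space into itself with
    norm at most M as soon as M^2 k(z,w) - f(z) conj(f(w)) k(b z, b w) is positive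
    semidefinite ([weighted_composition_bound]).  That T g belongs to the space
    comes from a Riesz-type criterion, [membership]: h is in the space if and only
    if 2 Re L(v) - |v|^2 is bounded above on the span of the kernels, where L is
    the functional that pairs with h; a maximizing sequence converges to h.

    For f in A(b, alpha) the kernel |f|^2 k^b - f f~ is positive by
    Cauchy-Schwarz ([kernel_dominates]).  Dividing it by (1 - b b~)^alpha keeps it
    positive ([psd_geometric_pow], a case of the Schur product theorem that needs
    only a geometric series) and gives exactly |f|^2 k - f f~ (k o b).  This is
    the first assertion.

    The other two use one fact of function theory: if phi is holomorphic and
    |phi| <= M on the disk, then (M^2 - phi phi~)/(1 - z w~) is positive
    ([pick_disk]).  It is obtained from the Cauchy formula on circles: multiplication
    by phi contracts the L^2 norm on the circle, and Cauchy's formula computes its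
    adjoint on the Szego kernels ([pick_circle]).  Analyticity is given as
    differentiability without continuity of the derivative, so the Cauchy formula
    is proved by Goursat's bisection ([bisection], [cone_boundary_null]).

    For the explicit bound on C_b take first alpha = 1.  With a = b(0), the
    function f = 1 - conj(a) b is the kernel (1 - b b~)/(1 - z w~) at the point 0,
    and 1/f is the bounded function 1/(1 - conj(a) z) composed with b; combining the
    two positivity facts gives c/(1 - z w~) - 1/(1 - b b~) >= 0 with
    c = (1+|a|)/(1-|a|) ([psd_composition_gap]).  The power alpha follows from the
    factorization of X^n - Y^n, again with the geometric series.

    For the last assertion, C_b = M_{1/f} (M_f C_b).  Here f = M_f C_b 1 belongs to
    A^2_alpha, hence is a locally uniform limit of combinations of kernels; applying
    the circle version of Pick's theorem to the reciprocals of these combinations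
    shows that 1/f multiplies A^2_alpha with norm at most |1/f|_oo
    ([pick_reciprocal], [reciprocal_multiplier]). *)

(** * Limits and derivatives of complex functions *)

(** Limits are stated with [Cmod] along an arbitrary filter, so that the same
    rules serve continuity in a real or complex variable and limits of
    sequences; the norms of the two normed-module structures on C differ from
    [Cmod] syntactically. *)
Definition clim {T : Type} (Fi : (T -> Prop) -> Prop) (f : T -> C) (l : C) : Prop :=
  forall eps : R, 0 < eps -> Fi (fun t => Cmod (f t - l)%C < eps).

Lemma Cmod_minus_sym (x y : C) : Cmod (x - y)%C = Cmod (y - x)%C.
Proof. rewrite <- Cmod_opp. f_equal. ring. Qed.

Lemma Cconj_RtoC (x : R) : Cconj (RtoC x) = RtoC x.
Proof. unfold Cconj, RtoC; simpl. f_equal. ring. Qed.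

Lemma Cmod_minus_lower (x y : C) : Cmod x - Cmod y <= Cmod (x - y)%C.
Proof.
  generalize (Cmod_triangle (x - y)%C y).
  replace (x - y + y)%C with x by ring. lra.
Qed.

Lemma Re_le_Cmod (z : C) : Re z <= Cmod z.
Proof.
  apply Rle_trans with (Rabs (fst z)); [apply Rle_abs|].
  eapply Rle_trans; [apply Rmax_l|apply Rmax_Cmod].
Qed.

Lemma clim_const {T} (Fi : (T -> Prop) -> Prop) {FF : Filter Fi} (c : C) :
  clim Fi (fun _ => c) c.
Proof.
  intros e He. apply filter_forall. intros _.
  replace (c - c)%C with (RtoC 0) by ring. now rewrite Cmod_0.
Qed.

Lemma clim_ext_loc {T} (Fi : (T -> Prop) -> Prop) {FF : Filter Fi} (f g : T -> C) (l : C) :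
  Fi (fun t => f t = g t) -> clim Fi f l -> clim Fi g l.
Proof.
  intros E H e He. generalize (filter_and (F := Fi) _ _ E (H e He)).
  apply filter_imp. intros t [<- h]. exact h.
Qed.

Lemma clim_ext {T} (Fi : (T -> Prop) -> Prop) {FF : Filter Fi} (f g : T -> C) (l : C) :
  (forall t, f t = g t) -> clim Fi f l -> clim Fi g l.
Proof. intros E. apply (clim_ext_loc Fi). now apply filter_forall. Qed.

Lemma clim_plus {T} (Fi : (T -> Prop) -> Prop) {FF : Filter Fi} (f g : T -> C) (l m : C) :
  clim Fi f l -> clim Fi g m -> clim Fi (fun t => f t + g t)%C (l + m)%C.
Proof.
  intros Hf Hg e He.
  generalize (filter_and (F := Fi) _ _ (Hf (e/2) ltac:(lra)) (Hg (e/2) ltac:(lra))).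
  apply filter_imp. intros t [h1 h2].
  replace (f t + g t - (l + m))%C with ((f t - l) + (g t - m))%C by ring.
  eapply Rle_lt_trans; [apply Cmod_triangle|lra].
Qed.

Lemma clim_conj {T} (Fi : (T -> Prop) -> Prop) {FF : Filter Fi} (f : T -> C) (l : C) :
  clim Fi f l -> clim Fi (fun t => Cconj (f t)) (Cconj l).
Proof.
  intros H e He. generalize (H e He). apply filter_imp. intros t h.
  rewrite <- Cminus_conj, Cmod_conj. exact h.
Qed.

Lemma clim_mult {T} (Fi : (T -> Prop) -> Prop) {FF : Filter Fi} (f g : T -> C) (l m : C) :
  clim Fi f l -> clim Fi g m -> clim Fi (fun t => f t * g t)%C (l * m)%C.
Proof.
  intros Hf Hg e He.
  pose proof (Cmod_ge_0 l). pose proof (Cmod_ge_0 m).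
  set (d := Rmin 1 (e / (Cmod l + Cmod m + 1))).
  assert (D : 0 < d).
  { apply Rmin_glb_lt; [lra|]. apply Rdiv_lt_0_compat; lra. }
  assert (D1 : d <= 1) by apply Rmin_l.
  assert (D2 : d * (Cmod l + Cmod m + 1) <= e).
  { apply Rle_trans with (e / (Cmod l + Cmod m + 1) * (Cmod l + Cmod m + 1)).
    - apply Rmult_le_compat_r; [lra|apply Rmin_r].
    - right. field. lra. }
  generalize (filter_and (F := Fi) _ _ (Hf d D) (Hg d D)).
  apply filter_imp. intros t [h1 h2].
  replace (f t * g t - l * m)%C with ((f t - l) * (g t - m) + (l * (g t - m) + m * (f t - l)))%C by ring.
  eapply Rle_lt_trans; [apply Cmod_triangle|].
  eapply Rle_lt_trans; [apply Rplus_le_compat_l, Cmod_triangle|].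
  rewrite !Cmod_mult.
  pose proof (Cmod_ge_0 (f t - l)%C). pose proof (Cmod_ge_0 (g t - m)%C).
  assert (Cmod (f t - l)%C * Cmod (g t - m)%C < d * 1) by nra.
  assert (Cmod l * Cmod (g t - m)%C <= Cmod l * d) by nra.
  assert (Cmod m * Cmod (f t - l)%C <= Cmod m * d) by nra.
  nra.
Qed.

Lemma clim_inv {T} (Fi : (T -> Prop) -> Prop) {FF : Filter Fi} (f : T -> C) (l : C) :
  l <> RtoC 0 -> clim Fi f l -> clim Fi (fun t => / f t)%C (/ l)%C.
Proof.
  intros Hl Hf e He.
  assert (L : 0 < Cmod l) by now apply Cmod_gt_0.
  assert (D : 0 < Cmod l / 2) by lra.
  assert (D' : 0 < e * (Cmod l * (Cmod l / 2))) by (repeat apply Rmult_lt_0_compat; lra).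
  generalize (filter_and (F := Fi) _ _ (Hf _ D) (Hf _ D')).
  apply filter_imp. intros t [h1 h2].
  assert (B : Cmod l / 2 < Cmod (f t)).
  { rewrite Cmod_minus_sym in h1. generalize (Cmod_minus_lower l (f t)). lra. }
  assert (N : f t <> RtoC 0) by (apply Cmod_gt_0; lra).
  replace (/ f t - / l)%C with ((l - f t) * / (l * f t))%C by (field; auto).
  rewrite Cmod_mult, Cmod_inv, Cmod_mult by now apply Cmult_neq_0.
  rewrite Cmod_minus_sym in h2.
  apply Rmult_lt_reg_r with (Cmod l * Cmod (f t)); [nra|].
  rewrite Rmult_assoc, Rinv_l, Rmult_1_r by nra.
  eapply Rlt_trans; [exact h2|]. apply Rmult_lt_compat_l; [lra|]. nra.
Qed.

Lemma clim_opp {T} (Fi : (T -> Prop) -> Prop) {FF : Filter Fi} (f : T -> C) (l : C) :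
  clim Fi f l -> clim Fi (fun t => - f t)%C (- l)%C.
Proof.
  intros H e He. generalize (H e He). apply filter_imp. intros t h.
  replace (- f t - - l)%C with (- (f t - l))%C by ring. now rewrite Cmod_opp.
Qed.

Lemma clim_minus {T} (Fi : (T -> Prop) -> Prop) {FF : Filter Fi} (f g : T -> C) (l m : C) :
  clim Fi f l -> clim Fi g m -> clim Fi (fun t => f t - g t)%C (l - m)%C.
Proof. intros Hf Hg. apply clim_plus; [auto|exact Hf|now apply clim_opp]. Qed.

Lemma clim_div {T} (Fi : (T -> Prop) -> Prop) {FF : Filter Fi} (f g : T -> C) (l m : C) :
  m <> RtoC 0 -> clim Fi f l -> clim Fi g m -> clim Fi (fun t => f t / g t)%C (l / m)%C.
Proof. intros N Hf Hg. apply clim_mult; [auto|exact Hf|now apply clim_inv]. Qed.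

Lemma clim_RtoC {T} (Fi : (T -> Prop) -> Prop) {FF : Filter Fi} (f : T -> R) (l : R) :
  filterlim f Fi (locally l) -> clim Fi (fun t => RtoC (f t)) (RtoC l).
Proof.
  intros H e He.
  assert (L : locally l (fun y : R => Rabs (y - l) < e)) by now exists (mkposreal e He).
  generalize (H _ L). unfold filtermap. apply filter_imp. intros t h.
  rewrite <- RtoC_minus, Cmod_R. exact h.
Qed.

Lemma clim_Re_ge_0 {T} (Fi : (T -> Prop) -> Prop) {FF : ProperFilter Fi} (f : T -> C) (l : C) :
  clim Fi f l -> Fi (fun t => 0 <= Re (f t)) -> 0 <= Re l.
Proof.
  intros H P. apply Rnot_lt_le. intros N.
  destruct (filter_ex (F := Fi) _ (filter_and (F := Fi) _ _ P (H (- Re l) ltac:(lra)))) as [t [h1 h2]].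
  pose proof (Re_le_Cmod (f t - l)%C) as h3.
  change (Re (f t - l)%C) with (Re (f t) + - Re l) in h3. lra.
Qed.

Definition cnear (z : C) (P : C -> Prop) : Prop :=
  exists d : R, 0 < d /\ forall y : C, Cmod (y - z)%C < d -> P y.

Global Instance cnear_filter (z : C) : Filter (cnear z).
Proof.
  constructor.
  - exists 1. split; [lra|auto].
  - intros P Q [d [Hd h]] [d' [Hd' h']]. exists (Rmin d d'). split.
    + now apply Rmin_glb_lt.
    + intros y Hy. split.
      * apply h. eapply Rlt_le_trans; [exact Hy|apply Rmin_l].
      * apply h'. eapply Rlt_le_trans; [exact Hy|apply Rmin_r].
  - intros P Q H [d [Hd h]]. exists d. split; auto.
Qed.

Lemma clim_id (z : C) : clim (cnear z) (fun y => y) z.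
Proof. intros e He. exists e. auto. Qed.

Lemma clim_comp {T} (Fi : (T -> Prop) -> Prop) {FF : Filter Fi} (g : T -> C) (z : C) (f : C -> C) (l : C) :
  clim Fi g z -> clim (cnear z) f l -> clim Fi (fun t => f (g t)) l.
Proof.
  intros Hg Hf e He. destruct (Hf e He) as [d [Hd h]].
  generalize (Hg d Hd). apply filter_imp. intros t. apply h.
Qed.

(** Caratheodory's form of complex differentiability: the difference quotient
    extends continuously to z, with the derivative as its value there.  The
    sum, product and quotient rules become algebraic identities. *)
Definition cdiff (F : C -> C) (z : C) : Prop :=
  exists G : C -> C, clim (cnear z) G (G z) /\
    cnear z (fun y => F y = F z + G y * (y - z))%C.

Lemma cdiff_clim F z : cdiff F z -> clim (cnear z) F (F z).
Proof.
  intros [G [HG E]].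
  apply (clim_ext_loc _ (fun y => F z + G y * (y - z))%C).
  - generalize E. apply filter_imp. auto.
  - assert (H : clim (cnear z) (fun y => F z + G y * (y - z))%C (F z + G z * (z - z))%C).
    { apply clim_plus; try typeclasses eauto; [apply clim_const; typeclasses eauto|].
      apply clim_mult; try typeclasses eauto; [exact HG|].
      apply clim_minus; try typeclasses eauto; [apply clim_id|apply clim_const; typeclasses eauto]. }
    now replace (F z + G z * (z - z))%C with (F z) in H by ring.
Qed.

Lemma cdiff_const c z : cdiff (fun _ => c) z.
Proof.
  exists (fun _ => RtoC 0). split; [apply clim_const; typeclasses eauto|].
  apply filter_forall. intros y. ring.
Qed.

Lemma cdiff_id z : cdiff (fun y => y) z.
Proof.
  exists (fun _ => RtoC 1). split; [apply clim_const; typeclasses eauto|].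
  apply filter_forall. intros y. ring.
Qed.

Lemma cdiff_plus F H z : cdiff F z -> cdiff H z -> cdiff (fun y => F y + H y)%C z.
Proof.
  intros [G [HG E]] [G' [HG' E']]. exists (fun y => G y + G' y)%C. split.
  - apply clim_plus; try typeclasses eauto; auto.
  - generalize (filter_and (F := cnear z) _ _ E E'). apply filter_imp. intros y [-> ->]. ring.
Qed.

Lemma cdiff_mult F H z : cdiff F z -> cdiff H z -> cdiff (fun y => F y * H y)%C z.
Proof.
  intros HF HH. pose proof (cdiff_clim _ _ HH) as CH.
  destruct HF as [G [HG E]]. destruct HH as [G' [HG' E']].
  exists (fun y => G y * H y + F z * G' y)%C. split.
  - apply clim_plus; try typeclasses eauto; apply clim_mult; try typeclasses eauto; auto.
    apply clim_const; typeclasses eauto.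
  - generalize (filter_and (F := cnear z) _ _ E E'). apply filter_imp. intros y [-> ->]. ring.
Qed.

Lemma cdiff_inv F z : F z <> RtoC 0 -> cdiff F z -> cdiff (fun y => / F y)%C z.
Proof.
  intros N HF. pose proof (cdiff_clim _ _ HF) as CF.
  destruct HF as [G [HG E]].
  exists (fun y => - (G y * (/ F y * / F z)))%C. split.
  - apply clim_opp; try typeclasses eauto. repeat apply clim_mult; try typeclasses eauto; auto.
    + now apply clim_inv; try typeclasses eauto.
    + apply clim_const; typeclasses eauto.
  - assert (P : 0 < Cmod (F z)) by now apply Cmod_gt_0.
    generalize (filter_and (F := cnear z) _ _ E (CF _ P)). apply filter_imp. intros y [h h'].
    assert (N' : F y <> RtoC 0).
    { intros Z. rewrite Z in h'. replace (0 - F z)%C with (- F z)%C in h' by ring.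
      rewrite Cmod_opp in h'. lra. }
    assert (h2 : (G y * (y - z) = F y - F z)%C) by (rewrite h; ring).
    replace (- (G y * (/ F y * / F z)) * (y - z))%C with (- (G y * (y - z)) * (/ F y * / F z))%C by ring.
    rewrite h2. field. auto.
Qed.

Lemma cdiff_opp F z : cdiff F z -> cdiff (fun y => - F y)%C z.
Proof.
  intros [G [HG E]]. exists (fun y => - G y)%C. split.
  - apply clim_opp; try typeclasses eauto; auto.
  - revert E. apply filter_imp. intros y ->. ring.
Qed.

Lemma cdiff_minus F H z : cdiff F z -> cdiff H z -> cdiff (fun y => F y - H y)%C z.
Proof. intros HF HH. apply cdiff_plus; [exact HF|now apply cdiff_opp]. Qed.

Lemma cdiff_pow F n z : cdiff F z -> cdiff (fun y => F y ^ n)%C z.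
Proof.
  intros H. induction n as [|n IH].
  - apply (cdiff_const 1).
  - apply (cdiff_mult F (fun y => F y ^ n)%C); auto.
Qed.

Lemma cdiff_of_ex_derive F z :
  ex_derive (K := C_AbsRing) (V := C_NormedModule) F z -> cdiff F z.
Proof.
  intros [l [_ Hd]]. change C in l. change (C -> C) in F. change C in z.
  specialize (Hd z (fun P H => H)).
  set (G := (fun y : C => match excluded_middle_informative (y = z) with
                   | left _ => (l : C) | right _ => (F y - F z) / (y - z) end)%C).
  assert (Gz : G z = l) by (unfold G; now destruct (excluded_middle_informative _)).
  assert (Gy : forall y, y <> z -> G y = ((F y - F z) / (y - z))%C)
    by (intros y n; unfold G; now destruct (excluded_middle_informative _)).
  exists G. split.
  - intros e He. rewrite Gz.
    destruct (Hd (mkposreal (e/2) ltac:(lra))) as [d h].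
    exists d. split; [apply cond_pos|]. intros y Hy.
    destruct (classic (y = z)) as [->|n].
    + rewrite Gz. replace (l - l)%C with (RtoC 0) by ring. now rewrite Cmod_0.
    + rewrite (Gy y n). specialize (h y Hy).
      change (Cmod (F y - F z - (y - z) * l)%C <= e / 2 * Cmod (y - z)%C) in h.
      assert (P : (y - z)%C <> RtoC 0) by now apply Cminus_eq_contra.
      assert (P' : 0 < Cmod (y - z)%C) by now apply Cmod_gt_0.
      replace ((F y - F z) / (y - z) - l)%C with ((F y - F z - (y - z) * l) / (y - z))%C by (field; exact P).
      rewrite Cmod_div by exact P.
      apply Rle_lt_trans with (e/2); [|lra].
      apply Rmult_le_reg_r with (Cmod (y - z)%C); [exact P'|].
      unfold Rdiv at 1. rewrite Rmult_assoc, Rinv_l, Rmult_1_r by lra. exact h.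
  - apply filter_forall. intros y.
    destruct (classic (y = z)) as [->|n]; [ring|].
    rewrite (Gy y n). field. now apply Cminus_eq_contra.
Qed.

(** * Integrals of complex functions of a real variable *)

(** Continuity is two-sided also at the end points; the integrands below are
    defined and continuous beyond them. *)
Definition ccont (f : R -> C) (a b : R) : Prop :=
  forall x, a <= x <= b -> clim (locally x) f (f x).

(** Integrals are taken componentwise.  The price is the factor 2 in
    [is_CInt_bound], which is harmless in estimates that tend to 0. *)
Definition is_CInt (f : R -> C) (a b : R) (l : C) : Prop :=
  is_RInt (fun t => Re (f t)) a b (Re l) /\ is_RInt (fun t => Im (f t)) a b (Im l).

Definition CInt (f : R -> C) (a b : R) : C :=
  (RInt (fun t => Re (f t)) a b, RInt (fun t => Im (f t)) a b).

Lemma is_CInt_unique f a b l : is_CInt f a b l -> CInt f a b = l.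
Proof.
  intros [H1 H2]. unfold CInt.
  rewrite (is_RInt_unique _ _ _ _ H1), (is_RInt_unique _ _ _ _ H2).
  now destruct l.
Qed.

Lemma Cmod_le_parts (z : C) : Cmod z <= Rabs (Re z) + Rabs (Im z).
Proof.
  replace z with (RtoC (Re z) + Ci * RtoC (Im z))%C at 1
    by (destruct z; apply injective_projections; simpl; ring).
  eapply Rle_trans; [apply Cmod_triangle|].
  rewrite Cmod_mult, Cmod_Ci, !Cmod_R. lra.
Qed.

Lemma Re_Im_le_Cmod (z : C) : Rabs (Re z) <= Cmod z /\ Rabs (Im z) <= Cmod z.
Proof.
  split; (eapply Rle_trans; [|apply Rmax_Cmod]); [apply Rmax_l|apply Rmax_r].
Qed.

Lemma clim_continuous (f : R -> C) x :
  clim (locally x) f (f x) ->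
  continuous (fun t => Re (f t)) x /\ continuous (fun t => Im (f t)) x.
Proof.
  intros H. split; intros P [e he]; generalize (H e (cond_pos e)); unfold filtermap;
    apply filter_imp; intros t h; apply he.
  - change (Rabs (Re (f t - f x)%C) < e). destruct (Re_Im_le_Cmod (f t - f x)%C). lra.
  - change (Rabs (Im (f t - f x)%C) < e). destruct (Re_Im_le_Cmod (f t - f x)%C). lra.
Qed.

Lemma CInt_correct f a b : a <= b -> ccont f a b -> is_CInt f a b (CInt f a b).
Proof.
  intros ab H. split; simpl; apply (RInt_correct (V := R_CompleteNormedModule));
    apply (ex_RInt_continuous (V := R_CompleteNormedModule));
    intros z Hz; rewrite Rmin_left, Rmax_right in Hz by exact ab;
    now apply clim_continuous, H.
Qed.

Lemma is_CInt_ext f g a b l :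
  (forall t, f t = g t) -> is_CInt f a b l -> is_CInt g a b l.
Proof. intros E. replace g with f by now apply functional_extensionality. auto. Qed.

Lemma is_CInt_plus f g a b l m :
  is_CInt f a b l -> is_CInt g a b m -> is_CInt (fun t => f t + g t)%C a b (l + m)%C.
Proof. intros [H1 H2] [H3 H4]. split; now apply (is_RInt_plus (V := R_NormedModule)). Qed.

Lemma is_CInt_scal (c : C) f a b l :
  is_CInt f a b l -> is_CInt (fun t => c * f t)%C a b (c * l)%C.
Proof.
  intros [H1 H2]. split.
  - apply (is_RInt_minus (V := R_NormedModule)); now apply (is_RInt_scal (V := R_NormedModule)).
  - apply (is_RInt_plus (V := R_NormedModule)); now apply (is_RInt_scal (V := R_NormedModule)).
Qed.

Lemma is_CInt_minus f g a b l m :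
  is_CInt f a b l -> is_CInt g a b m -> is_CInt (fun t => f t - g t)%C a b (l - m)%C.
Proof.
  intros H1 H2. apply is_CInt_ext with (fun t => f t + (-1)%R * g t)%C.
  - intros t. ring.
  - replace (l - m)%C with (l + (-1)%R * m)%C by ring.
    apply is_CInt_plus; [exact H1|now apply is_CInt_scal].
Qed.

Lemma is_CInt_conj f a b l : is_CInt f a b l -> is_CInt (fun t => Cconj (f t)) a b (Cconj l).
Proof.
  intros [H1 H2]. split; [exact H1|]. now apply (is_RInt_opp (V := R_NormedModule)).
Qed.

Lemma is_CInt_const (c : C) a b : is_CInt (fun _ => c) a b (RtoC (b - a) * c)%C.
Proof.
  split; simpl.
  - replace ((b - a) * fst c - 0 * snd c) with ((b - a) * fst c) by ring.
    apply (is_RInt_const (V := R_NormedModule)).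
  - replace ((b - a) * snd c + 0 * fst c) with ((b - a) * snd c) by ring.
    apply (is_RInt_const (V := R_NormedModule)).
Qed.

Lemma is_CInt_Chasles f a b c l m :
  is_CInt f a b l -> is_CInt f b c m -> is_CInt f a c (l + m)%C.
Proof.
  intros [H1 H2] [H3 H4]. split.
  - now apply (is_RInt_Chasles (V := R_NormedModule) _ a b c).
  - now apply (is_RInt_Chasles (V := R_NormedModule) _ a b c).
Qed.

Lemma is_CInt_bound f a b l M :
  a <= b -> (forall t, a <= t <= b -> Cmod (f t) <= M) -> is_CInt f a b l ->
  Cmod l <= 2 * M * (b - a).
Proof.
  intros ab H [H1 H2].
  assert (B1 : Rabs (Re l) <= (b - a) * M).
  { apply (norm_RInt_le_const (V := R_NormedModule) _ _ _ _ _ ab) with (2 := H1).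
    intros t Ht. eapply Rle_trans; [|now apply H]. apply Re_Im_le_Cmod. }
  assert (B2 : Rabs (Im l) <= (b - a) * M).
  { apply (norm_RInt_le_const (V := R_NormedModule) _ _ _ _ _ ab) with (2 := H2).
    intros t Ht. eapply Rle_trans; [|now apply H]. apply Re_Im_le_Cmod. }
  pose proof (Cmod_le_parts l). lra.
Qed.

Lemma is_CInt_Re_ge_0 f a b l :
  a <= b -> (forall t, 0 <= Re (f t)) -> is_CInt f a b l -> 0 <= Re l.
Proof.
  intros ab H [H1 _].
  assert (H0 : is_RInt (fun _ => 0) a b ((b - a) * 0))
    by apply (is_RInt_const (V := R_NormedModule)).
  rewrite Rmult_0_r in H0.
  apply (is_RInt_le (fun _ => 0) (fun t => Re (f t)) a b); auto.
Qed.

Definition zeta (r t : R) : C := (r * cos t, r * sin t).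

Lemma Cmod_zeta r t : 0 <= r -> Cmod (zeta r t) = r.
Proof.
  intros Hr. unfold Cmod, zeta; simpl.
  replace (r * cos t * (r * cos t * 1) + r * sin t * (r * sin t * 1))
    with (r² * ((sin t)² + (cos t)²)) by (unfold Rsqr; ring).
  rewrite sin2_cos2, Rmult_1_r. now apply sqrt_Rsqr.
Qed.

(** The derivative of zeta is i zeta. *)
Lemma zeta_int r a b : is_CInt (fun t => Ci * zeta r t)%C a b (zeta r b - zeta r a)%C.
Proof.
  split; simpl.
  - apply (is_RInt_derive (V := R_CompleteNormedModule) (fun t => r * cos t)).
    + intros x _. auto_derive; [easy|ring].
    + intros x _. apply (ex_derive_continuous (V := R_NormedModule)). auto_derive. easy.
  - apply (is_RInt_derive (V := R_CompleteNormedModule) (fun t => r * sin t)).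
    + intros x _. auto_derive; [easy|ring].
    + intros x _. apply (ex_derive_continuous (V := R_NormedModule)). auto_derive. easy.
Qed.

Lemma zeta_lip r a b : 0 <= r -> a <= b -> Cmod (zeta r b - zeta r a)%C <= 2 * r * (b - a).
Proof.
  intros Hr ab. apply (is_CInt_bound _ _ _ _ r ab) with (2 := zeta_int r a b).
  intros t _. rewrite Cmod_mult, Cmod_Ci, Cmod_zeta by exact Hr. lra.
Qed.

Lemma zeta_lipschitz r x y : 0 <= r -> Cmod (zeta r y - zeta r x)%C <= 2 * r * Rabs (y - x).
Proof.
  intros Hr. destruct (Rle_dec x y).
  - rewrite Rabs_pos_eq by lra. now apply zeta_lip.
  - rewrite Rabs_left by lra. rewrite Cmod_minus_sym.
    replace (- (y - x)) with (x - y) by ring. apply zeta_lip; lra.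
Qed.

Lemma zeta_clim r t : 0 <= r -> clim (locally t) (zeta r) (zeta r t).
Proof.
  intros Hr e He.
  assert (D : 0 < e / (2 * r + 1)) by (apply Rdiv_lt_0_compat; lra).
  exists (mkposreal _ D). intros y Hy. change (Rabs (y - t) < e / (2 * r + 1)) in Hy.
  assert (L := zeta_lipschitz r t y Hr).
  assert (Rabs (y - t) * (2 * r + 1) < e).
  { apply Rlt_le_trans with (e / (2 * r + 1) * (2 * r + 1)); [|right; field; lra].
    apply Rmult_lt_compat_r; lra. }
  pose proof (Rabs_pos (y - t)). nra.
Qed.

(** * Bisection of rectangles *)

Definition rect := (R * R * R * R)%type.

Definition half (a b a' b' : R) : Prop :=
  (a' = a /\ b' = (a + b) / 2) \/ (a' = (a + b) / 2 /\ b' = b).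

Definition quadrant (q q' : rect) : Prop :=
  half (fst (fst (fst q))) (snd (fst (fst q))) (fst (fst (fst q'))) (snd (fst (fst q'))) /\
  half (snd (fst q)) (snd q) (snd (fst q')) (snd q').

(** The common point is the supremum of the left ends. *)
Lemma nested_halves (a b : nat -> R) :
  a 0%nat <= b 0%nat -> (forall n, half (a n) (b n) (a (S n)) (b (S n))) ->
  exists x, forall n, a n <= x <= b n /\ b n - a n = (b 0%nat - a 0%nat) / 2 ^ n.
Proof.
  intros H0 H.
  assert (W : forall n, b n - a n = (b 0%nat - a 0%nat) / 2 ^ n).
  { induction n as [|n IH]; [simpl; field|].
    transitivity ((b n - a n) / 2).
    - destruct (H n) as [[-> ->]|[-> ->]]; field.
    - rewrite IH. simpl. field. apply pow_nonzero. lra. }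
  assert (P : forall n, a n <= b n).
  { intros n. enough (0 <= b n - a n) by lra. rewrite W.
    apply Rmult_le_pos; [lra|]. left. apply Rinv_0_lt_compat, pow_lt. lra. }
  assert (M : forall n k, a n <= a (k + n)%nat /\ b (k + n)%nat <= b n).
  { intros n. induction k as [|k IH]; [simpl; lra|].
    simpl. specialize (P (k + n)%nat). destruct (H (k + n)%nat) as [[-> ->]|[-> ->]]; lra. }
  assert (U : forall n m, a n <= b m).
  { intros n m. destruct (Nat.le_ge_cases n m) as [L|L].
    - destruct (M n (m - n)%nat) as [M1 _]. replace (m - n + n)%nat with m in M1 by lia.
      specialize (P m). lra.
    - destruct (M m (n - m)%nat) as [_ M1]. replace (n - m + m)%nat with n in M1 by lia.
      specialize (P n). lra. }
  destruct (completeness (fun x => exists n, x = a n)) as [x [X1 X2]].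
  - exists (b 0%nat). intros x [n ->]. apply U.
  - now exists (a 0%nat), 0%nat.
  - exists x. intros n. split; [split|apply W].
    + apply X1. now exists n.
    + apply X2. intros y [m ->]. apply U.
Qed.

Lemma half_width_small w d : 0 <= w -> 0 < d -> exists n, w / 2 ^ n < d.
Proof.
  intros Hw Hd.
  destruct (pow_lt_1_zero (/2)) with (y := d / (w + 1)) as [n Hn].
  - rewrite Rabs_pos_eq; lra.
  - apply Rdiv_lt_0_compat; lra.
  - exists n. specialize (Hn n (le_n n)).
    rewrite Rabs_pos_eq in Hn by (apply pow_le; lra).
    rewrite pow_inv in Hn.
    assert (P : 0 < / 2 ^ n) by (apply Rinv_0_lt_compat, pow_lt; lra).
    assert (w * / 2 ^ n <= (w + 1) * / 2 ^ n) by nra.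
    assert ((w + 1) * / 2 ^ n < (w + 1) * (d / (w + 1))) by (apply Rmult_lt_compat_l; lra).
    replace ((w + 1) * (d / (w + 1))) with d in H0 by (field; lra).
    unfold Rdiv. lra.
Qed.

(** If the property failed for the whole rectangle, it would fail for some
    quadrant, again for a quadrant of that one, and so on; the nested
    rectangles shrink to a point, near which the property holds. *)
Lemma bisection (P : R -> R -> R -> R -> Prop) (a b c d : R) :
  a <= b -> c <= d ->
  (forall s t u v, a <= s -> s <= t -> t <= b -> c <= u -> u <= v -> v <= d ->
     (forall s' t' u' v', half s t s' t' -> half u v u' v' -> P s' t' u' v') -> P s t u v) ->
  (forall x y, a <= x <= b -> c <= y <= d -> exists del, 0 < del /\
     forall s t u v, a <= s <= x -> x <= t <= b -> c <= u <= y -> y <= v <= d ->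
       t - s < del -> v - u < del -> P s t u v) ->
  P a b c d.
Proof.
  intros ab cd Hsub Hloc. apply NNPP. intros N.
  set (Q := fun q : rect => let '(s, t, u, v) := q in
     a <= s /\ s <= t /\ t <= b /\ c <= u /\ u <= v /\ v <= d /\ ~ P s t u v).
  assert (step : forall q : {q | Q q}, exists q' : {q | Q q},
    quadrant (proj1_sig q) (proj1_sig q')).
  { intros [[[[s t] u] v] (H1 & H2 & H3 & H4 & H5 & H6 & H7)]. apply NNPP. intros M.
    apply H7, Hsub; auto. intros s' t' u' v' h1 h2. apply NNPP. intros M'. apply M.
    assert (Q' : Q (s', t', u', v')).
    { unfold Q. destruct h1 as [[-> ->]|[-> ->]], h2 as [[-> ->]|[-> ->]];
        repeat split; auto; lra. }
    exists (exist _ _ Q'). split; simpl; auto. }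
  set (nxt := fun q => proj1_sig (constructive_indefinite_description _ (step q))).
  assert (Hn : forall q, quadrant (proj1_sig q) (proj1_sig (nxt q)))
    by (intros q; apply (proj2_sig (constructive_indefinite_description _ (step q)))).
  assert (Q0 : Q (a, b, c, d)) by (unfold Q; repeat split; auto; lra).
  set (qs := fun n => Nat.iter n nxt (exist _ _ Q0)).
  set (A := fun n => fst (fst (fst (proj1_sig (qs n))))).
  set (B := fun n => snd (fst (fst (proj1_sig (qs n))))).
  set (E := fun n => snd (fst (proj1_sig (qs n)))).
  set (F := fun n => snd (proj1_sig (qs n))).
  assert (HH : forall n, half (A n) (B n) (A (S n)) (B (S n)) /\
                         half (E n) (F n) (E (S n)) (F (S n))).
  { intros n. exact (Hn (qs n)). }
  assert (QQ : forall n, a <= A n /\ A n <= B n /\ B n <= b /\ c <= E n /\ E n <= F n /\ F n <= d /\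
             ~ P (A n) (B n) (E n) (F n)).
  { intros n. unfold A, B, E, F. destruct (qs n) as [[[[s t] u] v] h]. exact h. }
  destruct (nested_halves A B ab (fun n => proj1 (HH n))) as [x Hx].
  destruct (nested_halves E F cd (fun n => proj2 (HH n))) as [y Hy].
  destruct (Hloc x y) as [del [D H]].
  { exact (proj1 (Hx 0%nat)). }
  { exact (proj1 (Hy 0%nat)). }
  destruct (half_width_small (b - a + (d - c)) del) as [n Hdel]; [lra|exact D|].
  destruct (QQ n) as (q1 & q2 & q3 & q4 & q5 & q6 & q7).
  destruct (Hx n) as [x1 x2]. destruct (Hy n) as [y1 y2].
  change (A 0%nat) with a in x2. change (B 0%nat) with b in x2.
  change (E 0%nat) with c in y2. change (F 0%nat) with d in y2.
  assert (I : 0 < / 2 ^ n) by (apply Rinv_0_lt_compat, pow_lt; lra).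
  unfold Rdiv in *.
  apply q7, H; try lra; nra.
Qed.

(** An additive rectangle function whose value on small rectangles about each
    point is negligible against the square of their size vanishes.  This is
    the part of Goursat's argument that does not involve integrals; the
    squared size is exactly divided among the four quadrants. *)
Lemma additive_rectangle_null (Phi : R -> R -> R -> R -> C) a b c d :
  a <= b -> c <= d ->
  (forall s m t u v, a <= s -> s <= m -> m <= t -> t <= b -> c <= u -> u <= v -> v <= d ->
     Phi s t u v = (Phi s m u v + Phi m t u v)%C) ->
  (forall s t u m v, a <= s -> s <= t -> t <= b -> c <= u -> u <= m -> m <= v -> v <= d ->
     Phi s t u v = (Phi s t u m + Phi s t m v)%C) ->
  (forall x y eps, a <= x <= b -> c <= y <= d -> 0 < eps -> exists del, 0 < del /\
     forall s t u v, a <= s <= x -> x <= t <= b -> c <= u <= y -> y <= v <= d ->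
       t - s < del -> v - u < del ->
       Cmod (Phi s t u v) <= eps * (t - s + (v - u)) ^ 2) ->
  Phi a b c d = 0.
Proof.
  intros ab cd Hx Hy Hloc.
  assert (key : forall eps, 0 < eps -> Cmod (Phi a b c d) <= eps * (b - a + (d - c)) ^ 2).
  { intros eps He.
    apply (bisection (fun s t u v => Cmod (Phi s t u v) <= eps * (t - s + (v - u)) ^ 2) a b c d ab cd).
    - intros s t u v h1 h2 h3 h4 h5 h6 H.
      set (m := (s + t) / 2). set (n := (u + v) / 2).
      assert (Hm : s <= m <= t) by (unfold m; lra).
      assert (Hn : u <= n <= v) by (unfold n; lra).
      rewrite (Hx s m t u v), (Hy s m u n v), (Hy m t u n v) by lra.
      assert (L1 := H s m u n (or_introl (conj eq_refl eq_refl)) (or_introl (conj eq_refl eq_refl))).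
      assert (L2 := H s m n v (or_introl (conj eq_refl eq_refl)) (or_intror (conj eq_refl eq_refl))).
      assert (L3 := H m t u n (or_intror (conj eq_refl eq_refl)) (or_introl (conj eq_refl eq_refl))).
      assert (L4 := H m t n v (or_intror (conj eq_refl eq_refl)) (or_intror (conj eq_refl eq_refl))).
      eapply Rle_trans; [apply Cmod_triangle|].
      eapply Rle_trans; [apply Rplus_le_compat; apply Cmod_triangle|].
      replace (eps * (t - s + (v - u)) ^ 2) with
        ((eps * (m - s + (n - u)) ^ 2 + eps * (m - s + (v - n)) ^ 2) +
         (eps * (t - m + (n - u)) ^ 2 + eps * (t - m + (v - n)) ^ 2))
        by (unfold m, n; field).
      lra.
    - intros x y hx hy. now apply Hloc. }
  apply Cmod_eq_0, Rle_antisym; [|apply Cmod_ge_0].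
  apply Rnot_lt_le. intros N.
  set (K := (b - a + (d - c)) ^ 2) in *.
  assert (HK : 0 <= K) by (apply pow2_ge_0).
  specialize (key (Cmod (Phi a b c d) / (2 * (K + 1)))).
  assert (0 < Cmod (Phi a b c d) / (2 * (K + 1))) by (apply Rdiv_lt_0_compat; lra).
  specialize (key H). 
  replace (Cmod (Phi a b c d)) with (Cmod (Phi a b c d) / (2 * (K + 1)) * (2 * (K + 1))) in key at 1 by (field; lra).
  nra.
Qed.

(** * Goursat's theorem on a cone of circles *)

Ltac lim := repeat (first [apply clim_plus | apply clim_minus | apply clim_mult
  | apply clim_opp | apply clim_conj | (apply clim_const; typeclasses eauto)];
  try typeclasses eauto).

(** The circle of radius r contracted towards w: t = 1 gives the circle, t = 0
    the point w.  On the circle at level t, dz/(z - w) is i zeta/(zeta - w)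
    dtheta, independently of t, so that the Cauchy integral of F can be
    compared at all levels without a singular point at w. *)
Definition cone (w : C) (r t th : R) : C := (w + RtoC t * (zeta r th - w))%C.

Definition cauchy_kern (w : C) (r th : R) : C := (zeta r th / (zeta r th - w))%C.

Lemma zeta_far w r th : Cmod w < r -> r - Cmod w <= Cmod (zeta r th - w)%C.
Proof.
  intros H. pose proof (Cmod_ge_0 w). rewrite <- (Cmod_zeta r th) at 1 by lra. apply Cmod_minus_lower.
Qed.

Lemma zeta_neq w r th : Cmod w < r -> (zeta r th - w)%C <> 0.
Proof. intros H. apply Cmod_gt_0. pose proof (zeta_far w r th H). lra. Qed.

Lemma zeta_near w r th : Cmod w < r -> Cmod (zeta r th - w)%C <= 2 * r.
Proof.
  intros H. pose proof (Cmod_ge_0 w).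
  eapply Rle_trans; [apply Cmod_triangle|]. rewrite Cmod_opp, Cmod_zeta; lra.
Qed.

Lemma cone_in w r t th : Cmod w < r -> 0 <= t <= 1 -> Cmod (cone w r t th) <= r.
Proof.
  intros H Ht. unfold cone. pose proof (Cmod_ge_0 w).
  replace (w + t * (zeta r th - w))%C with (RtoC (1 - t) * w + RtoC t * zeta r th)%C
    by (rewrite RtoC_minus; ring).
  eapply Rle_trans; [apply Cmod_triangle|].
  rewrite !Cmod_mult, !Cmod_R, !Rabs_pos_eq, Cmod_zeta by lra. nra.
Qed.

Lemma cone_dist w r t th x y :
  Cmod w < r -> 0 <= x <= 1 ->
  Cmod (cone w r t th - cone w r x y)%C <= 2 * r * (Rabs (t - x) + Rabs (th - y)).
Proof.
  intros H Hx. unfold cone. pose proof (Cmod_ge_0 w).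
  replace (w + t * (zeta r th - w) - (w + x * (zeta r y - w)))%C
    with (RtoC (t - x) * (zeta r th - w) + RtoC x * (zeta r th - zeta r y))%C
    by (rewrite RtoC_minus; ring).
  eapply Rle_trans; [apply Cmod_triangle|].
  rewrite !Cmod_mult, !Cmod_R. pose proof (zeta_near w r th H).
  assert (L := zeta_lipschitz r y th ltac:(lra)).
  pose proof (Rabs_pos (t - x)). pose proof (Rabs_pos (th - y)).
  rewrite (Rabs_pos_eq x) by lra.
  pose proof (Cmod_ge_0 (zeta r th - zeta r y)%C). nra.
Qed.

Lemma cauchy_kern_bound w r th : Cmod w < r -> Cmod (cauchy_kern w r th) <= r / (r - Cmod w).
Proof.
  intros H. pose proof (Cmod_ge_0 w). unfold cauchy_kern.
  rewrite Cmod_div, Cmod_zeta by (try apply zeta_neq; lra).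
  apply Rmult_le_compat_l; [lra|]. apply Rinv_le_contravar; [lra|now apply zeta_far].
Qed.

Lemma clim_id_R (x : R) : clim (locally x) RtoC x.
Proof. apply (clim_RtoC (locally x) (fun y => y)). intros P H. exact H. Qed.

Lemma cauchy_kern_clim w r th : Cmod w < r -> clim (locally th) (cauchy_kern w r) (cauchy_kern w r th).
Proof.
  intros H. pose proof (Cmod_ge_0 w).
  unfold cauchy_kern. apply (clim_div (locally th)); [now apply zeta_neq|apply zeta_clim; lra|].
  lim. apply zeta_clim; lra.
Qed.

Lemma cone_clim_th w r t th : Cmod w < r ->
  clim (locally th) (fun y => cone w r t y) (cone w r t th).
Proof. intros H. pose proof (Cmod_ge_0 w). unfold cone. lim. apply zeta_clim; lra. Qed.

Lemma cone_clim_t w r t th : clim (locally t) (fun s => cone w r s th) (cone w r t th).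
Proof. unfold cone. lim. apply clim_id_R. Qed.

(** The integral of F(z) dz/(z - w) over the boundary of the rectangle
    [s,t] x [u,v] in the coordinates (t, theta) of the cone; on the radial
    sides the form is F dt/t. *)
Definition cone_boundary (F : C -> C) (w : C) (r s t u v : R) : C :=
  (CInt (fun th => (F (cone w r t th) - F (cone w r s th)) * (Ci * cauchy_kern w r th)) u v
   - CInt (fun p => (F (cone w r p v) - F (cone w r p u)) * / RtoC p) s t)%C.

Lemma cone_boundary_int_angle F w r s t u v : Cmod w < r ->
  (forall z, Cmod z <= r -> cdiff F z) -> 0 <= s <= 1 -> 0 <= t <= 1 -> u <= v ->
  is_CInt (fun th => (F (cone w r t th) - F (cone w r s th)) * (Ci * cauchy_kern w r th))%C u v
   (CInt (fun th => (F (cone w r t th) - F (cone w r s th)) * (Ci * cauchy_kern w r th))%C u v).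
Proof.
  intros H HF Hs Ht uv. apply CInt_correct; [exact uv|]. intros x _.
  apply (clim_mult (locally x));
    [apply (clim_minus (locally x))|apply (clim_mult (locally x)); [apply (clim_const (locally x))|]].
  - apply (clim_comp (locally x) _ (cone w r t x)); [now apply cone_clim_th|].
    apply cdiff_clim, HF, cone_in; auto.
  - apply (clim_comp (locally x) _ (cone w r s x)); [now apply cone_clim_th|].
    apply cdiff_clim, HF, cone_in; auto.
  - now apply cauchy_kern_clim.
Qed.

Lemma cone_boundary_int_radial F w r s t u v : Cmod w < r ->
  (forall z, Cmod z <= r -> cdiff F z) -> 0 < s -> s <= t -> t <= 1 ->
  is_CInt (fun p => (F (cone w r p v) - F (cone w r p u)) * / RtoC p)%C s t
   (CInt (fun p => (F (cone w r p v) - F (cone w r p u)) * / RtoC p)%C s t).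
Proof.
  intros H HF Hs Ht t1. apply CInt_correct; [exact Ht|]. intros x Hx. lim.
  - apply (clim_comp (locally x) (fun p => cone w r p v) (cone w r x v)); [now apply cone_clim_t|].
    apply cdiff_clim, HF, cone_in; auto; lra.
  - apply (clim_comp (locally x) (fun p => cone w r p u) (cone w r x u)); [now apply cone_clim_t|].
    apply cdiff_clim, HF, cone_in; auto; lra.
  - apply (clim_inv (locally x)); [|apply clim_id_R].
    intros E. apply RtoC_inj in E. lra.
Qed.

(** Goursat.  Near a point z0 replace F by its affine approximation.  The
    constant part contributes nothing, since the radial form does not depend
    on theta nor the angular one on t; the linear part contributes
    be (t - s)(zeta v - zeta u) on both pairs of sides.  What remains is the
    error of the approximation, which is small against the square of the
    size. *)
Lemma cone_boundary_null F w r a : Cmod w < r -> (forall z, Cmod z <= r -> cdiff F z) ->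
  0 < a -> a <= 1 -> cone_boundary F w r a 1 0 (2 * PI) = 0.
Proof.
  intros H HF Ha Ha1. pose proof (Cmod_ge_0 w) as W. pose proof PI_RGT_0.
  apply (additive_rectangle_null (fun s t u v => cone_boundary F w r s t u v) a 1 0 (2 * PI)); [lra|lra| | |].
  - intros s m t u v h1 h2 h3 h4 h5 h6 h7. unfold cone_boundary.
    assert (E1 := cone_boundary_int_angle F w r s m u v H HF ltac:(lra) ltac:(lra) h6).
    assert (E2 := cone_boundary_int_angle F w r m t u v H HF ltac:(lra) ltac:(lra) h6).
    assert (E3 := is_CInt_plus _ _ _ _ _ _ E1 E2).
    apply (is_CInt_ext _ (fun th => (F (cone w r t th) - F (cone w r s th)) * (Ci * cauchy_kern w r th))%C) in E3;
      [|intros; ring].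
    apply is_CInt_unique in E3. rewrite E3.
    assert (D1 := cone_boundary_int_radial F w r s m u v H HF ltac:(lra) h2 ltac:(lra)).
    assert (D2 := cone_boundary_int_radial F w r m t u v H HF ltac:(lra) h3 ltac:(lra)).
    assert (D3 := is_CInt_Chasles _ _ _ _ _ _ D1 D2).
    apply is_CInt_unique in D3. rewrite D3. ring.
  - intros s t u m v h1 h2 h3 h4 h5 h6 h7. unfold cone_boundary.
    assert (E1 := cone_boundary_int_radial F w r s t u m H HF ltac:(lra) h2 ltac:(lra)).
    assert (E2 := cone_boundary_int_radial F w r s t m v H HF ltac:(lra) h2 ltac:(lra)).
    assert (E3 := is_CInt_plus _ _ _ _ _ _ E1 E2).
    apply (is_CInt_ext _ (fun p => (F (cone w r p v) - F (cone w r p u)) * / RtoC p)%C) in E3;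
      [|intros; ring].
    apply is_CInt_unique in E3. rewrite E3.
    assert (D1 := cone_boundary_int_angle F w r s t u m H HF ltac:(lra) ltac:(lra) h5).
    assert (D2 := cone_boundary_int_angle F w r s t m v H HF ltac:(lra) ltac:(lra) h6).
    assert (D3 := is_CInt_Chasles _ _ _ _ _ _ D1 D2).
    apply is_CInt_unique in D3. rewrite D3. ring.
  - intros x y eps Hx Hy He.
    set (K := r / (r - Cmod w)).
    assert (HK : 0 < K) by (apply Rdiv_lt_0_compat; lra).
    assert (IA : 0 < / a) by now apply Rinv_0_lt_compat.
    (* Calibrated so that the error terms below, which have total weight
       8 r (K + 1/a) times the square of the size, are at most eps times it. *)
    set (e' := eps / (8 * r * (K + / a))).
    assert (P8 : 0 < 8 * r * (K + / a)) by (repeat apply Rmult_lt_0_compat; lra).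
    assert (He' : 0 < e') by (apply Rdiv_lt_0_compat; lra).
    set (z0 := cone w r x y).
    destruct (HF z0) as [G [HG [d1 [Hd1 E1]]]]; [apply cone_in; auto; lra|].
    destruct (HG e' He') as [d2 [Hd2 E2]].
    set (be := G z0) in *.
    set (E := fun z => (F z - F z0 - be * (z - z0))%C).
    set (d0 := Rmin d1 d2).
    assert (Hd0 : 0 < d0) by now apply Rmin_glb_lt.
    assert (HE : forall z, Cmod (z - z0)%C < d0 -> Cmod (E z) <= e' * Cmod (z - z0)%C).
    { intros z Hz. unfold E.
      rewrite E1 by (eapply Rlt_le_trans; [exact Hz|apply Rmin_l]).
      replace (F z0 + G z * (z - z0) - F z0 - be * (z - z0))%C with ((G z - be) * (z - z0))%C by ring.
      rewrite Cmod_mult. apply Rmult_le_compat_r; [apply Cmod_ge_0|].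
      left. apply E2. eapply Rlt_le_trans; [exact Hz|apply Rmin_r]. }
    exists (d0 / (4 * r)). split; [apply Rdiv_lt_0_compat; lra|].
    intros s t u v h1 h2 h3 h4 h5 h6.
    set (S := t - s + (v - u)).
    assert (HS : 2 * r * S < d0).
    { assert (S < 2 * (d0 / (4 * r))) by (unfold S; lra).
      apply Rlt_le_trans with (2 * r * (2 * (d0 / (4 * r)))); [apply Rmult_lt_compat_l; lra|].
      right. field. lra. }
    assert (HB : forall p q, s <= p <= t -> u <= q <= v -> Cmod (E (cone w r p q)) <= e' * (2 * r * S)).
    { intros p q hp hq.
      assert (D : Cmod (cone w r p q - z0)%C <= 2 * r * S).
      { eapply Rle_trans; [apply cone_dist; auto; lra|].
        apply Rmult_le_compat_l; [lra|].
        assert (Rabs (p - x) <= t - s) by (apply Rabs_le; lra).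
        assert (Rabs (q - y) <= v - u) by (apply Rabs_le; lra).
        unfold S; lra. }
      eapply Rle_trans; [apply HE; lra|]. apply Rmult_le_compat_l; lra. }
    set (L := (be * RtoC (t - s) * (zeta r v - zeta r u))%C).
    unfold cone_boundary.
    set (I1 := CInt _ u v). set (I2 := CInt _ s t).
    assert (B1 : Cmod (I1 - L)%C <= 2 * (2 * (e' * (2 * r * S)) * K) * (v - u)).
    { assert (J1 := cone_boundary_int_angle F w r s t u v H HF ltac:(lra) ltac:(lra) ltac:(lra)). fold I1 in J1.
      assert (J2 := is_CInt_scal (be * RtoC (t - s))%C _ _ _ _ (zeta_int r u v)). fold L in J2.
      apply is_CInt_bound with (3 := is_CInt_minus _ _ _ _ _ _ J1 J2); [lra|].
      intros th Hth.
      replace ((F (cone w r t th) - F (cone w r s th)) * (Ci * cauchy_kern w r th) - be * (t - s)%R * (Ci * zeta r th))%C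
        with ((E (cone w r t th) - E (cone w r s th)) * (Ci * cauchy_kern w r th))%C.
      2:{ unfold E, cauchy_kern, cone. rewrite RtoC_minus. field. now apply zeta_neq. }
      rewrite !Cmod_mult, Cmod_Ci, Rmult_1_l.
      apply Rmult_le_compat; [apply Cmod_ge_0|apply Cmod_ge_0| |now apply cauchy_kern_bound].
      eapply Rle_trans; [apply Cmod_triangle|]. rewrite Cmod_opp.
      generalize (HB t th ltac:(lra) Hth) (HB s th ltac:(lra) Hth). lra. }
    assert (B2 : Cmod (I2 - L)%C <= 2 * (2 * (e' * (2 * r * S)) * / a) * (t - s)).
    { assert (J1 := cone_boundary_int_radial F w r s t u v H HF ltac:(lra) ltac:(lra) ltac:(lra)). fold I2 in J1.
      assert (J2 := is_CInt_const (be * (zeta r v - zeta r u))%C s t).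
      replace (RtoC (t - s) * (be * (zeta r v - zeta r u)))%C with L in J2 by (unfold L; ring).
      apply is_CInt_bound with (3 := is_CInt_minus _ _ _ _ _ _ J1 J2); [lra|].
      intros p Hp.
      assert (P0 : RtoC p <> 0) by (intros Z; apply RtoC_inj in Z; lra).
      replace ((F (cone w r p v) - F (cone w r p u)) * / p - be * (zeta r v - zeta r u))%C
        with ((E (cone w r p v) - E (cone w r p u)) * / p)%C.
      2:{ unfold E, cone. field. exact P0. }
      rewrite Cmod_mult, Cmod_inv, Cmod_R, Rabs_pos_eq by (auto; lra).
      apply Rmult_le_compat; [apply Cmod_ge_0|left; apply Rinv_0_lt_compat; lra| |apply Rinv_le_contravar; lra].
      eapply Rle_trans; [apply Cmod_triangle|]. rewrite Cmod_opp.
      generalize (HB p v Hp ltac:(lra)) (HB p u Hp ltac:(lra)). lra. }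
    replace (I1 - I2)%C with ((I1 - L) - (I2 - L))%C by ring.
    eapply Rle_trans; [apply Cmod_triangle|]. rewrite Cmod_opp.
    apply Rle_trans with (8 * r * (K + / a) * e' * S ^ 2).
    2:{ right. f_equal. unfold e', Rdiv. rewrite <- (Rmult_comm (_ * / _)), Rmult_assoc, Rinv_l; lra. }
    assert (0 <= v - u <= S) by (unfold S; lra).
    assert (0 <= t - s <= S) by (unfold S; lra).
    assert (Q0 : 0 <= e' * r) by (apply Rmult_le_pos; lra).
    assert (Q1 : 0 <= e' * r * S * K) by (apply Rmult_le_pos; [apply Rmult_le_pos|]; lra).
    assert (Q2 : 0 <= e' * r * S * / a) by (apply Rmult_le_pos; [apply Rmult_le_pos|]; lra).
    pose proof (Rmult_le_compat_l _ _ _ Q1 (proj2 H1)).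
    pose proof (Rmult_le_compat_l _ _ _ Q2 (proj2 H2)).
    simpl. lra.
Qed.

(** * The Cauchy formula on a circle *)

Lemma zeta_period r : zeta r (2 * PI) = zeta r 0.
Proof. unfold zeta. now rewrite cos_2PI, sin_2PI, cos_0, sin_0. Qed.

(** The two radial sides theta = 0 and theta = 2 pi coincide and cancel. *)
Lemma cone_circle_constant F w r a : Cmod w < r -> (forall z, Cmod z <= r -> cdiff F z) ->
  0 < a -> a <= 1 ->
  is_CInt (fun th => (F (zeta r th) - F (cone w r a th)) * cauchy_kern w r th)%C 0 (2 * PI) 0.
Proof.
  intros H HF Ha Ha1. pose proof PI_RGT_0.
  assert (N := cone_boundary_null F w r a H HF Ha Ha1). unfold cone_boundary in N.
  assert (Z : is_CInt (fun p => (F (cone w r p (2 * PI)) - F (cone w r p 0)) * / RtoC p)%C a 1 0).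
  { pose proof (is_CInt_const 0 a 1) as Z. rewrite Cmult_0_r in Z.
    revert Z. apply is_CInt_ext. intros p. unfold cone. rewrite zeta_period. ring. }
  apply is_CInt_unique in Z. rewrite Z in N.
  assert (J := cone_boundary_int_angle F w r a 1 0 (2 * PI) H HF ltac:(lra) ltac:(lra) ltac:(lra)).
  set (I := CInt _ 0 (2 * PI)) in *.
  replace I with (RtoC 0) in J by (rewrite <- N; ring).
  apply (is_CInt_scal (- Ci)%C) in J.
  replace (- Ci * 0)%C with (RtoC 0) in J by ring.
  revert J. apply is_CInt_ext. intros th.
  replace (cone w r 1 th) with (zeta r th) by (unfold cone; ring).
  transitivity (- (Ci * Ci) * ((F (zeta r th) - F (cone w r a th)) * cauchy_kern w r th))%C; [ring|].
  replace (Ci * Ci)%C with (RtoC (-1)) by (apply injective_projections; simpl; ring).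
  ring.
Qed.

Lemma cauchy_kern_int w r : Cmod w < r -> is_CInt (cauchy_kern w r) 0 (2 * PI) (CInt (cauchy_kern w r) 0 (2 * PI)).
Proof.
  intros H. pose proof PI_RGT_0. apply CInt_correct; [lra|]. intros x _. now apply cauchy_kern_clim.
Qed.

(** As the level a tends to 0, the circles shrink to w and the integral tends
    to F w times the integral of the kernel. *)
Lemma cauchy_formula_unnormalized F w r : Cmod w < r -> (forall z, Cmod z <= r -> cdiff F z) ->
  is_CInt (fun th => F (zeta r th) * cauchy_kern w r th)%C 0 (2 * PI)
    (F w * CInt (cauchy_kern w r) 0 (2 * PI))%C.
Proof.
  intros H HF. pose proof PI_RGT_0. pose proof (Cmod_ge_0 w).
  assert (J : is_CInt (fun th => F (zeta r th) * cauchy_kern w r th)%C 0 (2 * PI)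
     (CInt (fun th => F (zeta r th) * cauchy_kern w r th)%C 0 (2 * PI))).
  { apply CInt_correct; [lra|]. intros x _. apply (clim_mult (locally x)).
    - apply (clim_comp (locally x) _ (zeta r x)); [apply zeta_clim; lra|].
      apply cdiff_clim, HF. rewrite Cmod_zeta; lra.
    - now apply cauchy_kern_clim. }
  set (I := CInt (fun th => F (zeta r th) * cauchy_kern w r th)%C 0 (2 * PI)) in *.
  assert (K := cauchy_kern_int w r H). set (k := CInt (cauchy_kern w r) 0 (2 * PI)) in *.
  replace (F w * k)%C with I; [exact J|].
  apply Ceq_minus, Cmod_eq_0, Rle_antisym; [|apply Cmod_ge_0].
  apply Rnot_lt_le. intros N.
  set (B := r / (r - Cmod w)).
  assert (HB : 0 < B) by (apply Rdiv_lt_0_compat; lra).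
  set (e := Cmod (I - F w * k)%C) in *.
  assert (P : 0 < 4 * (B * (2 * PI))) by (apply Rmult_lt_0_compat; [lra|apply Rmult_lt_0_compat; lra]).
  set (e' := e / (4 * (B * (2 * PI)))).
  assert (He' : 0 < e') by (apply Rdiv_lt_0_compat; lra).
  destruct (cdiff_clim F w (HF w ltac:(lra)) e' He') as [d [Hd h]].
  set (a := Rmin 1 (d / (4 * r))).
  assert (A1 : 0 < a) by (apply Rmin_glb_lt; [lra|apply Rdiv_lt_0_compat; lra]).
  assert (A2 : a <= 1) by apply Rmin_l.
  assert (A3 : 2 * r * a < d).
  { apply Rle_lt_trans with (2 * r * (d / (4 * r))).
    - apply Rmult_le_compat_l; [lra|apply Rmin_r].
    - replace (2 * r * (d / (4 * r))) with (d / 2) by (field; lra). lra. }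
  assert (Q := is_CInt_minus _ _ _ _ _ _
     (is_CInt_minus _ _ _ _ _ _ J (is_CInt_scal (F w) _ _ _ _ K))
     (cone_circle_constant F w r a H HF A1 A2)).
  apply is_CInt_bound with (M := e' * B) in Q; [|lra|].
  - replace (I - F w * k - 0)%C with (I - F w * k)%C in Q by ring. fold e in Q.
    assert (e' * (4 * (B * (2 * PI))) = e)
      by (unfold e', Rdiv; rewrite Rmult_assoc, Rinv_l; lra).
    lra.
  - intros th _.
    replace (F (zeta r th) * cauchy_kern w r th - F w * cauchy_kern w r th - (F (zeta r th) - F (cone w r a th)) * cauchy_kern w r th)%C
      with ((F (cone w r a th) - F w) * cauchy_kern w r th)%C by ring.
    rewrite Cmod_mult. apply Rmult_le_compat; try apply Cmod_ge_0; [|now apply cauchy_kern_bound].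
    left. apply h. unfold cone.
    replace (w + a * (zeta r th - w) - w)%C with (RtoC a * (zeta r th - w))%C by ring.
    rewrite Cmod_mult, Cmod_R, Rabs_pos_eq by lra.
    pose proof (zeta_near w r th H). nra.
Qed.

(** The reproducing kernel of the Hardy space of the disk of radius r. *)
Definition szego (r : R) (w z : C) : C := (/ (1 - z * Cconj w / RtoC (r * r)))%C.

Lemma szego_neq r w z : 0 < r -> Cmod w < r -> Cmod z <= r ->
  (1 - z * Cconj w / RtoC (r * r))%C <> 0.
Proof.
  intros Hr Hw Hz E.
  assert (L := Cmod_minus_lower 1 (z * Cconj w / RtoC (r * r))%C). rewrite E, Cmod_0, Cmod_1 in L.
  assert (R0 : RtoC (r * r) <> 0) by (intros Z; apply RtoC_inj in Z; nra).
  rewrite Cmod_div, Cmod_mult, Cmod_conj, Cmod_R, Rabs_pos_eq in L by (auto; nra).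
  pose proof (Cmod_ge_0 w). pose proof (Cmod_ge_0 z).
  assert (Cmod z * Cmod w / (r * r) < 1).
  { apply Rmult_lt_reg_r with (r * r); [nra|]. unfold Rdiv. rewrite Rmult_assoc, Rinv_l by nra. nra. }
  lra.
Qed.

Lemma szego_cdiff r w z : 0 < r -> Cmod w < r -> Cmod z <= r -> cdiff (szego r w) z.
Proof.
  intros Hr Hw Hz. apply cdiff_inv; [now apply szego_neq|].
  apply cdiff_minus; [apply cdiff_const|].
  apply cdiff_mult; [apply cdiff_mult; [apply cdiff_id|apply cdiff_const]|apply cdiff_const].
Qed.

(** On the circle conj zeta = r^2 / zeta, which turns the conjugate of the
    Szego kernel into the Cauchy kernel. *)
Lemma szego_circle r w th : 0 < r -> Cmod w < r ->
  Cconj (szego r w (zeta r th)) = cauchy_kern w r th.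
Proof.
  intros Hr Hw. unfold szego, cauchy_kern.
  assert (R0 : RtoC r <> 0) by (intros Z; apply RtoC_inj in Z; lra).
  assert (Z0 : zeta r th <> 0) by (apply Cmod_gt_0; rewrite Cmod_zeta; lra).
  assert (C0 : Cconj (zeta r th) = (RtoC (r * r) / zeta r th)%C).
  { assert (S := sin2_cos2 th). unfold Rsqr in S.
    assert (M : (Cconj (zeta r th) * zeta r th)%C = RtoC (r * r)).
    { apply injective_projections; simpl; [|ring].
      transitivity (r * r * (sin th * sin th + cos th * cos th)); [ring|rewrite S; ring]. }
    rewrite <- M. field. exact Z0. }
  rewrite Cinv_conj by (apply szego_neq; auto; rewrite Cmod_zeta; lra).
  rewrite Cminus_conj. unfold Cdiv. rewrite !Cmult_conj, Cconj_conj, Cinv_conj, Cconj_RtoC, Cconj_RtoC, C0.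
  2:{ intros Z; apply RtoC_inj in Z; nra. }
  pose proof (zeta_neq w r th Hw).
  rewrite RtoC_mult. field. repeat split; auto.
Qed.

(** The Cauchy kernel is the conjugate of the Szego kernel, which is
    holomorphic on the closed disk with value 1 at 0; so the mean value
    property, which is the case w = 0 of [cauchy_formula_unnormalized], computes its
    integral. *)
Lemma cauchy_kern_total w r : 0 < r -> Cmod w < r ->
  is_CInt (cauchy_kern w r) 0 (2 * PI) (RtoC (2 * PI)).
Proof.
  intros Hr Hw.
  assert (N0 : Cmod (RtoC 0) < r) by now rewrite Cmod_0.
  assert (C0 : forall th, cauchy_kern 0 r th = RtoC 1).
  { intros th. unfold cauchy_kern. pose proof (zeta_neq 0 r th N0) as Z.
    replace (zeta r th - 0)%C with (zeta r th) in * by ring. field. exact Z. }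
  assert (K0 : CInt (cauchy_kern 0 r) 0 (2 * PI) = RtoC (2 * PI)).
  { apply is_CInt_unique. apply (is_CInt_ext (fun _ => RtoC 1)).
    - intros th. now rewrite C0.
    - replace (RtoC (2 * PI)) with (RtoC (2 * PI - 0) * 1)%C by (rewrite Rminus_0_r; ring). apply is_CInt_const. }
  assert (M := cauchy_formula_unnormalized (szego r w) 0 r N0 (fun z Hz => szego_cdiff r w z Hr Hw Hz)).
  rewrite K0 in M.
  apply is_CInt_conj in M.
  replace (Cconj (szego r w 0 * RtoC (2 * PI))) with (RtoC (2 * PI)) in M.
  2:{ unfold szego, Cdiv. rewrite !Cmult_0_l. replace (/ (1 - 0))%C with (RtoC 1) by (field; rewrite <- RtoC_minus, Rminus_0_r; apply C1_nz).
      rewrite Cmult_1_l. symmetry. apply Cconj_RtoC. }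
  revert M. apply is_CInt_ext. intros th.
  now rewrite C0, Cmult_1_r, szego_circle.
Qed.

Lemma cauchy_formula F w r : 0 < r -> Cmod w < r -> (forall z, Cmod z <= r -> cdiff F z) ->
  is_CInt (fun th => F (zeta r th) * Cconj (szego r w (zeta r th)))%C 0 (2 * PI)
    (RtoC (2 * PI) * F w)%C.
Proof.
  intros Hr Hw HF.
  apply (is_CInt_ext (fun th => F (zeta r th) * cauchy_kern w r th)%C).
  - intros th. now rewrite szego_circle.
  - rewrite Cmult_comm, <- (is_CInt_unique _ _ _ _ (cauchy_kern_total w r Hr Hw)). now apply cauchy_formula_unnormalized.
Qed.

(** * Positive semidefinite kernels *)

Definition csum {A : Type} (f : A -> C) (l : list A) : C :=
  fold_right (fun a s => (f a + s)%C) (RtoC 0) l.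

Lemma csum_ext {A} (f g : A -> C) l : (forall a, In a l -> f a = g a) -> csum f l = csum g l.
Proof.
  induction l as [|a l IH]; intros H; [easy|].
  simpl. rewrite H by now left. f_equal. apply IH. intros x Hx. apply H. now right.
Qed.

Lemma csum_plus {A} (f g : A -> C) l :
  csum (fun a => f a + g a)%C l = (csum f l + csum g l)%C.
Proof. induction l as [|a l IH]; simpl; [|rewrite IH]; ring. Qed.

Lemma csum_scal {A} (c : C) (f : A -> C) l : csum (fun a => c * f a)%C l = (c * csum f l)%C.
Proof. induction l as [|a l IH]; simpl; [|rewrite IH]; ring. Qed.

Lemma csum_app {A} (f : A -> C) l m : csum f (l ++ m) = (csum f l + csum f m)%C.
Proof. induction l as [|a l IH]; simpl; [|rewrite IH]; ring. Qed.

Lemma csum_map {A B} (g : A -> B) (f : B -> C) l : csum f (map g l) = csum (fun a => f (g a)) l.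
Proof. induction l as [|a l IH]; simpl; [|rewrite IH]; easy. Qed.

Lemma csum_conj {A} (f : A -> C) l : Cconj (csum f l) = csum (fun a => Cconj (f a)) l.
Proof. induction l as [|a l IH]; simpl; [apply Cconj_RtoC|]. now rewrite Cplus_conj, IH. Qed.

Lemma csum_clim {T A} (Fi : (T -> Prop) -> Prop) {FF : Filter Fi} (f : T -> A -> C) (g : A -> C) l :
  (forall a, In a l -> clim Fi (fun t => f t a) (g a)) ->
  clim Fi (fun t => csum (f t) l) (csum g l).
Proof.
  induction l as [|a l IH]; intros H; simpl.
  - now apply clim_const.
  - apply (clim_plus Fi); [apply H; now left|]. apply IH. intros b Hb. apply H. now right.
Qed.

Lemma csum_cdiff {A} (f : A -> C -> C) l z :
  (forall a, In a l -> cdiff (f a) z) -> cdiff (fun y => csum (fun a => f a y) l) z.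
Proof.
  induction l as [|a l IH]; intros H; simpl.
  - apply cdiff_const.
  - apply cdiff_plus; [apply H; now left|]. apply IH. intros b Hb. apply H. now right.
Qed.

(** The order of conjugates makes [quad k l] the squared norm of the
    combination of kernels with coefficients and points in l. *)
Definition quad {X : Type} (K : X -> X -> C) (l : list (C * X)) : C :=
  csum (fun p => Cconj (fst p) * csum (fun q => fst q * K (snd p) (snd q)) l)%C l.

Definition psd {X : Type} (K : X -> X -> C) : Prop := forall l, 0 <= Re (quad K l).

Lemma quad_ext {X} (K K' : X -> X -> C) l :
  (forall x y, In x (map snd l) -> In y (map snd l) -> K x y = K' x y) -> quad K l = quad K' l.
Proof.
  intros H. apply csum_ext. intros p Hp. f_equal. apply csum_ext. intros q Hq.
  f_equal. apply H; now apply in_map.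
Qed.

Lemma quad_plus {X} (K K' : X -> X -> C) l :
  quad (fun x y => K x y + K' x y)%C l = (quad K l + quad K' l)%C.
Proof.
  unfold quad. rewrite <- csum_plus. apply csum_ext. intros p _.
  rewrite <- Cmult_plus_distr_l, <- csum_plus. f_equal. apply csum_ext. intros q _. ring.
Qed.

Lemma quad_scal {X} (c : C) (K : X -> X -> C) l :
  quad (fun x y => c * K x y)%C l = (c * quad K l)%C.
Proof.
  unfold quad. rewrite <- csum_scal. apply csum_ext. intros p _.
  rewrite (csum_ext (fun q => fst q * (c * K (snd p) (snd q)))%C (fun q => c * (fst q * K (snd p) (snd q)))%C)
    by (intros; ring).
  rewrite csum_scal. ring.
Qed.

Lemma quad_rank_one {X} (f : X -> C) l :
  quad (fun x y => f x * Cconj (f y))%C l = RtoC (Cmod (csum (fun p => fst p * Cconj (f (snd p)))%C l) ^ 2).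
Proof.
  rewrite Cmod2_conj. unfold quad. rewrite csum_conj.
  rewrite <- csum_scal. apply csum_ext. intros p _.
  rewrite Cmult_conj, Cconj_conj.
  rewrite (csum_ext (fun q => fst q * (f (snd p) * Cconj (f (snd q))))%C
             (fun q => f (snd p) * (fst q * Cconj (f (snd q))))%C) by (intros; ring).
  rewrite csum_scal. ring.
Qed.

(** A factor f(x) conj(f(y)) can be moved into the coefficients. *)
Lemma quad_twist {X} (f : X -> C) (K : X -> X -> C) l :
  quad (fun x y => f x * Cconj (f y) * K x y)%C l =
  quad K (map (fun p => ((fst p * Cconj (f (snd p)))%C, snd p)) l).
Proof.
  unfold quad. rewrite csum_map. apply csum_ext. intros p _. simpl.
  rewrite csum_map, Cmult_conj, Cconj_conj. simpl.
  rewrite <- Cmult_assoc, <- (csum_scal (f (snd p))). f_equal. apply csum_ext. intros q _. ring.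
Qed.

Lemma quad_pull {X Y} (u : X -> Y) (K : Y -> Y -> C) l :
  quad (fun x y => K (u x) (u y)) l = quad K (map (fun p => (fst p, u (snd p))) l).
Proof.
  unfold quad. rewrite csum_map. apply csum_ext. intros p _. simpl. now rewrite csum_map.
Qed.

Lemma quad_clim {T X} (Fi : (T -> Prop) -> Prop) {FF : Filter Fi} (Kt : T -> X -> X -> C) (K : X -> X -> C) l :
  (forall x y, In x (map snd l) -> In y (map snd l) -> clim Fi (fun t => Kt t x y) (K x y)) ->
  clim Fi (fun t => quad (Kt t) l) (quad K l).
Proof.
  intros H. apply (csum_clim Fi). intros p Hp.
  apply (clim_mult Fi); [now apply clim_const|].
  apply (csum_clim Fi). intros q Hq.
  apply (clim_mult Fi); [now apply clim_const|].
  apply H; now apply in_map.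
Qed.

Lemma psd_ext {X} (K K' : X -> X -> C) : (forall x y, K x y = K' x y) -> psd K -> psd K'.
Proof. intros E H l. rewrite <- (quad_ext K K') by auto. apply H. Qed.

Lemma psd_plus {X} (K K' : X -> X -> C) : psd K -> psd K' -> psd (fun x y => K x y + K' x y)%C.
Proof.
  intros H H' l. rewrite quad_plus. specialize (H l). specialize (H' l).
  change (0 <= Re (quad K l) + Re (quad K' l)). lra.
Qed.

Lemma psd_scal {X} (c : R) (K : X -> X -> C) : 0 <= c -> psd K -> psd (fun x y => c * K x y)%C.
Proof.
  intros Hc H l. rewrite quad_scal. specialize (H l).
  replace (Re (c * quad K l)%C) with (c * Re (quad K l)) by (simpl; unfold Re; ring).
  now apply Rmult_le_pos.
Qed.

Lemma psd_twist {X} (f : X -> C) (K : X -> X -> C) :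
  psd K -> psd (fun x y => f x * Cconj (f y) * K x y)%C.
Proof. intros H l. rewrite quad_twist. apply H. Qed.

Lemma psd_pull {X Y} (u : X -> Y) (K : Y -> Y -> C) : psd K -> psd (fun x y => K (u x) (u y)).
Proof. intros H l. rewrite quad_pull. apply H. Qed.

Lemma psd_lim {T X} (Fi : (T -> Prop) -> Prop) {FF : ProperFilter Fi} (Kt : T -> X -> X -> C) (K : X -> X -> C) :
  (forall x y, clim Fi (fun t => Kt t x y) (K x y)) ->
  (forall l, Fi (fun t => 0 <= Re (quad (Kt t) l))) -> psd K.
Proof.
  intros H P l. apply (clim_Re_ge_0 Fi (fun t => quad (Kt t) l)).
  - apply (quad_clim Fi). auto.
  - apply P.
Qed.

Lemma one_minus_neq z : Cmod z < 1 -> (1 - z)%C <> 0.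
Proof.
  intros H E. pose proof (Cmod_minus_lower 1 z) as L. rewrite E, Cmod_0, Cmod_1 in L. lra.
Qed.

Lemma Cmod_prod_conj_lt_1 z w : Cmod z < 1 -> Cmod w < 1 -> Cmod (z * Cconj w)%C < 1.
Proof.
  intros Hz Hw. rewrite Cmod_mult, Cmod_conj.
  pose proof (Cmod_ge_0 z). pose proof (Cmod_ge_0 w). nra.
Qed.

Lemma clim_pow_0 z : Cmod z < 1 -> clim eventually (fun n => z ^ n)%C 0.
Proof.
  intros H e He. pose proof (Cmod_ge_0 z).
  destruct (pow_lt_1_zero (Cmod z)) with (y := e) as [N HN]; [rewrite Rabs_pos_eq; lra|exact He|].
  exists N. intros n Hn. replace (z ^ n - 0)%C with (z ^ n)%C by ring.
  rewrite Cmod_pow. specialize (HN n Hn). now rewrite Rabs_pos_eq in HN by (apply pow_le; lra).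
Qed.

(** Let Q be the quotient.  Then P = Q - u u~ Q, and summing u^j u^j~ P over
    j < n shows that Q - (u u~)^n Q is positive; let n tend to infinity. *)
Lemma psd_geometric {X} (u : X -> C) (P : X -> X -> C) :
  (forall x, Cmod (u x) < 1) -> psd P ->
  psd (fun x y => P x y / (1 - u x * Cconj (u y)))%C.
Proof.
  intros Hu HP. set (Q := fun x y => (P x y / (1 - u x * Cconj (u y)))%C).
  assert (N : forall x y, (1 - u x * Cconj (u y))%C <> 0)
    by (intros x y; apply one_minus_neq, Cmod_prod_conj_lt_1; auto).
  assert (S : forall n, psd (fun x y => Q x y - (u x * Cconj (u y)) ^ n * Q x y)%C).
  { induction n as [|n IH].
    - intros l. rewrite (quad_ext _ (fun x y => RtoC 0 * Q x y)%C) by (intros; simpl; ring).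
      rewrite quad_scal, Cmult_0_l. simpl. lra.
    - apply (psd_ext (fun x y => P x y + u x * Cconj (u y) * (Q x y - (u x * Cconj (u y)) ^ n * Q x y))%C).
      + intros x y. rewrite Cpow_S.
        replace (P x y) with (Q x y * (1 - u x * Cconj (u y)))%C by (unfold Q; now field).
        ring.
      + apply psd_plus; [exact HP|]. now apply psd_twist. }
  apply (psd_lim eventually (fun n x y => Q x y - (u x * Cconj (u y)) ^ n * Q x y)%C).
  - intros x y.
    assert (L : clim eventually (fun n => Q x y - (u x * Cconj (u y)) ^ n * Q x y)%C (Q x y - 0 * Q x y)%C).
    { apply (clim_minus eventually); [apply (clim_const eventually)|].
      apply (clim_mult eventually); [|apply (clim_const eventually)].
      apply clim_pow_0, Cmod_prod_conj_lt_1; auto. }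
    now replace (Q x y - 0 * Q x y)%C with (Q x y) in L by ring.
  - intros l. apply (filter_forall (F := eventually)). intros n. apply S.
Qed.

Lemma psd_geometric_pow {X} (u : X -> C) (P : X -> X -> C) n :
  (forall x, Cmod (u x) < 1) -> psd P ->
  psd (fun x y => P x y / (1 - u x * Cconj (u y)) ^ n)%C.
Proof.
  intros Hu HP.
  assert (N : forall x y, (1 - u x * Cconj (u y))%C <> 0)
    by (intros x y; apply one_minus_neq, Cmod_prod_conj_lt_1; auto).
  induction n as [|n IH].
  - revert HP. apply psd_ext. intros x y. simpl. field.
  - apply (psd_geometric u _ Hu) in IH. revert IH. apply psd_ext. intros x y.
    rewrite Cpow_S. field. split; [apply Cpow_nz; auto|auto].
Qed.

(** * Pick positivity on a circle *)

Lemma cauchy_sum {A} F r (a : A -> C) (w : A -> C) l :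
  0 < r -> (forall p, In p l -> Cmod (w p) < r) -> (forall z, Cmod z <= r -> cdiff F z) ->
  is_CInt (fun th => F (zeta r th) * Cconj (csum (fun p => a p * szego r (w p) (zeta r th)) l))%C 0 (2 * PI)
    (RtoC (2 * PI) * csum (fun p => Cconj (a p) * F (w p)) l)%C.
Proof.
  intros Hr Hw HF. induction l as [|p l IH]; simpl.
  - pose proof (is_CInt_const 0 0 (2 * PI)) as Z. rewrite Cmult_0_r in *. revert Z.
    apply is_CInt_ext. intros th. rewrite Cconj_RtoC. ring.
  - assert (H1 := cauchy_formula F (w p) r Hr (Hw p (or_introl eq_refl)) HF).
    apply (is_CInt_scal (Cconj (a p))) in H1.
    assert (H2 := is_CInt_plus _ _ _ _ _ _ H1 (IH (fun q Hq => Hw q (or_intror Hq)))).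
    match goal with |- is_CInt _ _ _ ?v => match type of H2 with is_CInt _ _ _ ?v' =>
      replace v with v' by ring end end.
    revert H2. apply is_CInt_ext. intros th. rewrite Cplus_conj, Cmult_conj. ring.
Qed.

(** Let h be the combination of Szego kernels with coefficients c_p, and h'
    that with coefficients c_p conj(phi(x_p)), which is the projection of
    conj(phi) h to the Hardy space.  By Cauchy's formula the integrals of
    phi h' h~ and of |h'|^2 agree, and so the quadratic form is, up to the
    factor 2 pi, the integral of M^2 |h|^2 - 2 phi h' h~ + |h'|^2.  The real
    part of this integrand is at least (M |h| - |h'|)^2. *)
Lemma pick_circle (phi : C -> C) (M r : R) (l : list (C * C)) :
  0 < r -> 0 <= M ->
  (forall z, Cmod z <= r -> cdiff phi z) -> (forall z, Cmod z <= r -> Cmod (phi z) <= M) ->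
  (forall p, In p l -> Cmod (snd p) < r) ->
  0 <= Re (quad (fun z w => (RtoC (M * M) - phi z * Cconj (phi w)) * szego r w z)%C l).
Proof.
  intros Hr HM Hd Hb Hl. pose proof PI_RGT_0.
  set (h := fun z => csum (fun p => fst p * szego r (snd p) z)%C l).
  set (h' := fun z => csum (fun p => fst p * Cconj (phi (snd p)) * szego r (snd p) z)%C l).
  assert (Dh : forall z, Cmod z <= r -> cdiff h z).
  { intros z Hz. apply csum_cdiff. intros p Hp. apply cdiff_mult; [apply cdiff_const|].
    apply szego_cdiff; auto. }
  assert (Dh' : forall z, Cmod z <= r -> cdiff h' z).
  { intros z Hz. apply csum_cdiff. intros p Hp. apply cdiff_mult; [apply cdiff_const|].
    apply szego_cdiff; auto. }
  assert (Dph : forall z, Cmod z <= r -> cdiff (fun z => phi z * h' z)%C z).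
  { intros z Hz. apply cdiff_mult; auto. }
  assert (J1 := cauchy_sum h r fst snd l Hr Hl Dh).
  assert (J2 := cauchy_sum (fun z => phi z * h' z)%C r fst snd l Hr Hl Dph).
  assert (J3 := cauchy_sum h' r (fun p => fst p * Cconj (phi (snd p)))%C snd l Hr Hl Dh').
  cbv beta in J1, J2, J3.
  set (A := csum (fun p => Cconj (fst p) * h (snd p))%C l) in J1.
  set (B := csum (fun p => Cconj (fst p) * (phi (snd p) * h' (snd p)))%C l) in J2.
  replace (csum (fun p => Cconj (fst p * Cconj (phi (snd p))) * h' (snd p))%C l) with B in J3.
  2:{ apply csum_ext. intros p _. rewrite Cmult_conj, Cconj_conj. ring. }
  assert (E : quad (fun z w => (RtoC (M * M) - phi z * Cconj (phi w)) * szego r w z)%C l = (RtoC (M * M) * A - B)%C).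
  { unfold quad, A, B. rewrite <- csum_scal.
    replace (csum (fun p => Cconj (fst p) * (phi (snd p) * h' (snd p)))%C l) with
      (- csum (fun p => - (1) * (Cconj (fst p) * (phi (snd p) * h' (snd p))))%C l)%C
      by (rewrite csum_scal; ring).
    match goal with |- _ = (?x - - ?y)%C => replace (x - - y)%C with (x + y)%C by ring end.
    rewrite <- csum_plus. apply csum_ext. intros p _.
    unfold h, h'.
    transitivity (Cconj (fst p) * (RtoC (M * M) * csum (fun q => fst q * szego r (snd q) (snd p)) l
       + (- phi (snd p)) * csum (fun q => fst q * Cconj (phi (snd q)) * szego r (snd q) (snd p)) l))%C; [|ring].
    f_equal. rewrite <- !csum_scal, <- csum_plus. apply csum_ext. intros q _. ring. }
  rewrite E.
  assert (J := is_CInt_plus _ _ _ _ _ _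
    (is_CInt_minus _ _ _ _ _ _ (is_CInt_scal (RtoC (M * M)) _ _ _ _ J1) (is_CInt_scal 2 _ _ _ _ J2)) J3).
  match type of J with is_CInt _ _ _ ?v =>
    replace v with (RtoC (2 * PI) * (RtoC (M * M) * A - B))%C in J by ring end.
  apply is_CInt_Re_ge_0 in J; [|lra|].
  - replace (Re (RtoC (2 * PI) * (RtoC (M * M) * A - B))%C) with (2 * PI * Re (RtoC (M * M) * A - B)%C) in J
      by (simpl; unfold Re; simpl; ring).
    apply Rmult_le_reg_l with (2 * PI); lra.
  - intros th. set (z := zeta r th).
    fold (h z). fold (h' z).
    rewrite <- !Cmod2_conj.
    assert (P := Re_le_Cmod (phi z * h' z * Cconj (h z))%C).
    rewrite !Cmod_mult, Cmod_conj in P.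
    assert (Bz : Cmod (phi z) <= M) by (apply Hb; unfold z; rewrite Cmod_zeta; lra).
        set (X := (phi z * h' z * Cconj (h z))%C) in *.
    assert (Q : forall a b c : R, Re (RtoC a * RtoC b - 2 * X + RtoC c)%C = a * b - 2 * Re X + c)
      by (intros; simpl; unfold Re; ring).
    rewrite Q. clear Q.
    pose proof (Cmod_ge_0 (h z)). pose proof (Cmod_ge_0 (h' z)).
    assert (Cmod (phi z) * Cmod (h' z) * Cmod (h z) <= M * Cmod (h' z) * Cmod (h z)).
    { repeat apply Rmult_le_compat_r; auto. }
    pose proof (pow2_ge_0 (M * Cmod (h z) - Cmod (h' z))). nra.
Qed.

(** * Reproducing kernel Hilbert spaces *)

(** The square of [hnorm], which expands without square roots. *)
Definition norm_sq {X} {k : X -> X -> C} (H : RKHS k) (f : X -> C) : R := Re (inner H f f).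

Lemma hnorm_sq {X} {k : X -> X -> C} (H : RKHS k) f : carrier H f -> hnorm H f * hnorm H f = norm_sq H f.
Proof. intros Hf. apply sqrt_sqrt. now apply inner_nonneg. Qed.

Lemma hnorm_ge_0 {X} {k : X -> X -> C} (H : RKHS k) f : 0 <= hnorm H f.
Proof. apply sqrt_pos. Qed.

Lemma carrier_minus {X} {k : X -> X -> C} (H : RKHS k) f g :
  carrier H f -> carrier H g -> carrier H (fun x => f x - g x)%C.
Proof.
  intros Hf Hg.
  replace (fun x => f x - g x)%C with (fun x => f x + (RtoC (-1) * g x))%C
    by (apply functional_extensionality; intros; ring).
  apply (carrier_plus k H f (fun x => RtoC (-1) * g x)%C); [exact Hf|now apply carrier_scal].
Qed.

Lemma inner_plus_r {X} {k : X -> X -> C} (H : RKHS k) f g h :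
  carrier H f -> carrier H g -> carrier H h ->
  inner H h (fun x => f x + g x)%C = (inner H h f + inner H h g)%C.
Proof.
  intros Hf Hg Hh. rewrite inner_conj; [|now apply carrier_plus|exact Hh].
  rewrite inner_plus, Cplus_conj by auto. now rewrite <- !inner_conj.
Qed.

Lemma inner_scal_r {X} {k : X -> X -> C} (H : RKHS k) c f h :
  carrier H f -> carrier H h ->
  inner H h (fun x => c * f x)%C = (Cconj c * inner H h f)%C.
Proof.
  intros Hf Hh. rewrite inner_conj; [|now apply carrier_scal|exact Hh].
  rewrite inner_scal, Cmult_conj by auto. now rewrite <- inner_conj.
Qed.

Lemma inner_self {X} {k : X -> X -> C} (H : RKHS k) f : carrier H f -> inner H f f = RtoC (norm_sq H f).
Proof.
  intros Hf. assert (E := inner_conj k H f f Hf Hf).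
  unfold norm_sq. destruct (inner H f f) as [a b]. unfold Cconj in E; simpl in E.
  injection E. intros E'. apply injective_projections; simpl; lra.
Qed.

Lemma Re_inner_sym {X} {k : X -> X -> C} (H : RKHS k) f g :
  carrier H f -> carrier H g -> Re (inner H g f) = Re (inner H f g).
Proof. intros Hf Hg. rewrite inner_conj by auto. reflexivity. Qed.

Lemma norm_sq_plus {X} {k : X -> X -> C} (H : RKHS k) f g : carrier H f -> carrier H g ->
  norm_sq H (fun x => f x + g x)%C = norm_sq H f + norm_sq H g + 2 * Re (inner H f g).
Proof.
  intros Hf Hg. unfold norm_sq at 1.
  rewrite inner_plus, !inner_plus_r by (auto; now apply carrier_plus).
  assert (E := Re_inner_sym H f g Hf Hg). unfold norm_sq, Re in *. simpl. lra.
Qed.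

Lemma norm_sq_scal {X} {k : X -> X -> C} (H : RKHS k) c f : carrier H f ->
  norm_sq H (fun x => c * f x)%C = Cmod c ^ 2 * norm_sq H f.
Proof.
  intros Hf. unfold norm_sq at 1.
  rewrite inner_scal, inner_scal_r by (auto; now apply carrier_scal).
  rewrite inner_self by auto. rewrite Cmult_assoc, <- Cmod2_conj, <- RtoC_mult. reflexivity.
Qed.

Lemma norm_sq_minus {X} {k : X -> X -> C} (H : RKHS k) f g : carrier H f -> carrier H g ->
  norm_sq H (fun x => f x - g x)%C = norm_sq H f + norm_sq H g - 2 * Re (inner H f g).
Proof.
  intros Hf Hg.
  replace (fun x => f x - g x)%C with (fun x => f x + (RtoC (-1) * g x))%C
    by (apply functional_extensionality; intros; ring).
  rewrite (norm_sq_plus H f (fun x => RtoC (-1) * g x)%C), norm_sq_scal, inner_scal_r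
    by (auto; now apply carrier_scal).
  rewrite Cmod_R, Rabs_left, Cconj_RtoC by lra. simpl. unfold Re. ring.
Qed.

(** The squared norm of f - t <f,g> g is nonnegative for every real t. *)
Lemma cauchy_schwarz {X} {k : X -> X -> C} (H : RKHS k) f g : carrier H f -> carrier H g ->
  Cmod (inner H f g) <= hnorm H f * hnorm H g.
Proof.
  intros Hf Hg.
  set (z := inner H f g).
  assert (Q : forall t : R, 0 <= norm_sq H f + t * t * (Cmod z ^ 2 * norm_sq H g) - 2 * t * Cmod z ^ 2).
  { intros t.
    assert (P := inner_nonneg k H _ (carrier_minus H f (fun x => (RtoC t * z) * g x)%C Hf (carrier_scal k H _ g Hg))).
    change (0 <= norm_sq H (fun x => f x - RtoC t * z * g x)%C) in P.
    rewrite (norm_sq_minus H f (fun x => RtoC t * z * g x)%C), norm_sq_scal, inner_scal_r in P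
      by (auto; now apply carrier_scal).
    fold z in P. rewrite Cmult_conj, Cconj_RtoC, <- Cmult_assoc, (Cmult_comm (Cconj z)), <- Cmod2_conj, <- RtoC_mult in P.
    rewrite Cmod_mult, Cmod_R, Rpow_mult_distr, <- Rsqr_pow2, <- Rsqr_abs in P.
    unfold Rsqr in P. change (Re (RtoC (t * Cmod z ^ 2))) with (t * Cmod z ^ 2) in P. lra. }
  pose proof (inner_nonneg k H f Hf : 0 <= norm_sq H f) as Nf.
  pose proof (inner_nonneg k H g Hg : 0 <= norm_sq H g) as Ng.
  pose proof (Cmod_ge_0 z) as Nz.
  assert (S : Cmod z ^ 2 <= norm_sq H f * norm_sq H g).
  { destruct (Req_dec (Cmod z) 0) as [E|E]; [rewrite E; simpl; nra|].
    assert (Z2 : 0 < Cmod z ^ 2) by (apply pow_lt; lra).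
    destruct (Req_dec (norm_sq H g) 0) as [G|G].
    - exfalso. rewrite G in Q. specialize (Q ((norm_sq H f + 1) / Cmod z ^ 2)).
      replace (2 * ((norm_sq H f + 1) / Cmod z ^ 2) * Cmod z ^ 2) with (2 * (norm_sq H f + 1)) in Q by (field; lra).
      lra.
    - specialize (Q (/ norm_sq H g)).
      assert (0 <= norm_sq H g * (norm_sq H f + / norm_sq H g * / norm_sq H g * (Cmod z ^ 2 * norm_sq H g) - 2 * / norm_sq H g * Cmod z ^ 2))
        by (apply Rmult_le_pos; lra).
      replace (norm_sq H g * (norm_sq H f + / norm_sq H g * / norm_sq H g * (Cmod z ^ 2 * norm_sq H g) - 2 * / norm_sq H g * Cmod z ^ 2))
        with (norm_sq H f * norm_sq H g - Cmod z ^ 2) in H0 by (field; lra).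
      lra. }
  rewrite <- (hnorm_sq H f Hf), <- (hnorm_sq H g Hg) in S.
  apply Rsqr_incr_0_var; [|apply Rmult_le_pos; apply hnorm_ge_0].
  unfold Rsqr. lra.
Qed.

Definition kernel_comb {X} (k : X -> X -> C) (l : list (C * X)) (x : X) : C :=
  csum (fun p => fst p * k x (snd p))%C l.

Lemma kernel_comb_carrier {X} {k : X -> X -> C} (H : RKHS k) l : carrier H (kernel_comb k l).
Proof.
  induction l as [|p l IH]; [exact (carrier_zero k H)|].
  apply (carrier_plus k H (fun x => fst p * k x (snd p))%C (kernel_comb k l)); [|exact IH].
  apply (carrier_scal k H (fst p) (fun x => k x (snd p))), kernel_in.
Qed.

Lemma kernel_comb_inner {X} {k : X -> X -> C} (H : RKHS k) l g : carrier H g ->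
  inner H (kernel_comb k l) g = csum (fun p => fst p * Cconj (g (snd p)))%C l.
Proof.
  intros Hg. induction l as [|p l IH]; simpl.
  - assert (E := inner_scal k H 0 (kernel_comb k nil) g (kernel_comb_carrier H nil) Hg).
    rewrite Cmult_0_l in E. rewrite <- E. f_equal. apply functional_extensionality.
    intros x. simpl. unfold kernel_comb. simpl. ring.
  - change (kernel_comb k (p :: l)) with (fun x => (fun x => fst p * k x (snd p))%C x + kernel_comb k l x)%C.
    rewrite inner_plus, IH; auto; [|apply (carrier_scal k H (fst p) (fun x => k x (snd p))), kernel_in|apply kernel_comb_carrier].
    f_equal. rewrite (inner_scal k H (fst p) (fun x => k x (snd p))) by (auto; apply kernel_in).
    f_equal. rewrite inner_conj by (auto; apply kernel_in). now rewrite reproducing.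
Qed.

Lemma norm_sq_comb {X} {k : X -> X -> C} (H : RKHS k) l : norm_sq H (kernel_comb k l) = Re (quad k l).
Proof.
  unfold norm_sq. rewrite kernel_comb_inner by apply kernel_comb_carrier.
  rewrite <- (re_conj (quad k l)). f_equal. unfold quad. rewrite csum_conj. apply csum_ext.
  intros p _. now rewrite Cmult_conj, Cconj_conj.
Qed.

(** Norm convergence implies pointwise convergence, locally uniformly where
    the diagonal of the kernel is bounded. *)
Lemma point_bound {X} {k : X -> X -> C} (H : RKHS k) f x : carrier H f ->
  Cmod (f x) <= hnorm H f * sqrt (Re (k x x)).
Proof.
  intros Hf. rewrite <- (reproducing k H f x Hf) at 1.
  eapply Rle_trans; [apply cauchy_schwarz; [exact Hf|apply kernel_in]|].
  right. f_equal. unfold hnorm, norm_of. now rewrite reproducing by apply kernel_in.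
Qed.

Lemma kernel_diag {X} {k : X -> X -> C} (H : RKHS k) x :
  0 <= Re (k x x) /\ k x x = RtoC (Re (k x x)).
Proof.
  assert (E := inner_self H (fun z => k z x) (kernel_in k H x)).
  unfold norm_sq in E. rewrite reproducing in E by apply kernel_in. split; [|exact E].
  assert (P := inner_nonneg k H (fun z => k z x) (kernel_in k H x)).
  now rewrite reproducing in P by apply kernel_in.
Qed.

Definition list_scal {X} (c : C) (l : list (C * X)) : list (C * X) :=
  map (fun p => ((c * fst p)%C, snd p)) l.

Lemma kernel_comb_scal {X} (k : X -> X -> C) c l :
  kernel_comb k (list_scal c l) = (fun x => c * kernel_comb k l x)%C.
Proof.
  apply functional_extensionality. intros x. unfold kernel_comb, list_scal.
  rewrite csum_map, <- csum_scal. apply csum_ext. intros p _. simpl. ring.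
Qed.

Lemma kernel_comb_app {X} (k : X -> X -> C) l m :
  kernel_comb k (l ++ m) = (fun x => kernel_comb k l x + kernel_comb k m x)%C.
Proof. apply functional_extensionality. intros x. apply csum_app. Qed.

Lemma clim_unique {T} (Fi : (T -> Prop) -> Prop) {FF : ProperFilter Fi} (f : T -> C) l m :
  clim Fi f l -> clim Fi f m -> l = m.
Proof.
  intros H1 H2. apply Ceq_minus, Cmod_eq_0, Rle_antisym; [|apply Cmod_ge_0].
  apply Rnot_lt_le. intros N. set (e := Cmod (l - m)%C) in *.
  destruct (filter_ex (F := Fi) _ (filter_and (F := Fi) _ _ (H1 (e / 2) ltac:(lra)) (H2 (e / 2) ltac:(lra))))
    as [t [h1 h2]].
  assert (e <= Cmod (f t - l)%C + Cmod (f t - m)%C); [|lra].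
  unfold e. replace (l - m)%C with (- (f t - l) + (f t - m))%C by ring.
  eapply Rle_trans; [apply Cmod_triangle|]. rewrite Cmod_opp. lra.
Qed.

Lemma inv_small e : 0 < e -> exists N, forall n, (N <= n)%nat -> / (INR n + 1) < e.
Proof.
  intros He. destruct (archimed_cor1 e He) as [N [h1 h2]]. exists N. intros n Hn.
  eapply Rle_lt_trans; [|exact h1]. apply Rinv_le_contravar.
  - now apply lt_0_INR.
  - apply le_INR in Hn. lra.
Qed.

(** If h belongs to the space, then 2 Re <v,h> - |v|^2 = |h|^2 - |v - h|^2.
    The left side makes sense for every h when v is a combination of kernels.
    By the parallelogram identity, combinations that nearly maximize it form a
    Cauchy sequence; perturbing them by multiples of k(., x) shows that their
    values at x tend to h(x), so that h is the limit. *)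
Lemma membership {X} {k : X -> X -> C} (H : RKHS k) (h : X -> C) (B : R) :
  (forall l, 2 * Re (csum (fun p => fst p * Cconj (h (snd p)))%C l) - norm_sq H (kernel_comb k l) <= B) ->
  carrier H h /\ norm_sq H h <= B /\
  exists s : nat -> list (C * X), forall eps, 0 < eps ->
    eventually (fun n => hnorm H (fun x => kernel_comb k (s n) x - h x)%C < eps).
Proof.
  intros HB.
  set (L := fun l => Re (csum (fun p => fst p * Cconj (h (snd p)))%C l)).
  set (J := fun l => 2 * L l - norm_sq H (kernel_comb k l)).
  destruct (completeness (fun y => exists l, y = J l)) as [S [S1 S2]].
  { exists B. intros y [l ->]. apply HB. }
  { now exists (J nil), nil. }
  assert (JS : forall l, J l <= S) by (intros l; apply S1; now exists l).
  assert (SB : S <= B) by (apply S2; intros y [l ->]; apply HB).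
  assert (Pn : forall n, 0 < / (INR n + 1)) by (intros n; apply Rinv_0_lt_compat; pose proof (pos_INR n); lra).
  assert (ex : forall n, exists l, S - / (INR n + 1) < J l).
  { intros n. apply NNPP. intros N. specialize (Pn n).
    assert (S <= S - / (INR n + 1)); [|lra].
    apply S2. intros y [l ->]. apply Rnot_lt_le. intros M. apply N. now exists l. }
  set (s := fun n => proj1_sig (constructive_indefinite_description _ (ex n))).
  assert (Hs : forall n, S - / (INR n + 1) < J (s n))
    by (intros n; apply (proj2_sig (constructive_indefinite_description _ (ex n)))).
  assert (CC : forall l, carrier H (kernel_comb k l)) by (intros; apply kernel_comb_carrier).
  (* The midpoint of two lists is again a candidate for the supremum, so the
     parallelogram identity bounds the distance of two near-maximizers. *)
  assert (near_max : forall l m, norm_sq H (fun x => kernel_comb k l x - kernel_comb k m x)%C <= 2 * (2 * S - J l - J m)).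
  { intros l m. assert (A := JS (list_scal (/ 2) (l ++ m))). unfold J, L in A.
    unfold list_scal at 1 in A. rewrite csum_map in A. simpl in A.
    rewrite (csum_ext _ (fun p => / 2 * (fst p * Cconj (h (snd p))))%C) in A by (intros; ring).
    rewrite csum_scal, csum_app in A.
    rewrite kernel_comb_scal, norm_sq_scal, kernel_comb_app, norm_sq_plus in A by (auto; rewrite ?kernel_comb_app; try apply (carrier_plus k H (kernel_comb k l) (kernel_comb k m)); auto).
    rewrite norm_sq_minus by auto.
    fold (L l) in A.
    replace (Re (/ 2 * (csum (fun p => fst p * Cconj (h (snd p))) l + csum (fun p => fst p * Cconj (h (snd p))) m))%C)
      with (/ 2 * (L l + L m)) in A.
    2:{ rewrite <- RtoC_inv by lra. unfold L, Re. simpl. ring. }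
    rewrite <- RtoC_inv, Cmod_R, Rabs_pos_eq in A by lra.
    unfold J. simpl in A. lra. }
  destruct (carrier_complete k H (fun n => kernel_comb k (s n))) as [g [Hg Lg]].
  { intros n. apply CC. }
  { intros eps He. destruct (inv_small (eps * eps / 4)) as [N HN]; [nra|].
    exists N. intros n m Hn Hm.
    rewrite <- (sqrt_square eps) by lra.
    apply sqrt_lt_1_alt. split; [apply (inner_nonneg k H), carrier_minus; auto|].
    eapply Rle_lt_trans; [apply near_max|].
    generalize (HN n Hn) (HN m Hm) (Hs n) (Hs m). lra. }
  assert (Lg' : forall eps, 0 < eps -> eventually (fun n => hnorm H (fun x => kernel_comb k (s n) x - g x)%C < eps)).
  { intros eps He. apply is_lim_seq_spec in Lg. destruct (Lg (mkposreal eps He)) as [N HN].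
    exists N. intros n Hn. specialize (HN n Hn). simpl in HN. rewrite Rminus_0_r in HN.
    eapply Rle_lt_trans; [apply Rle_abs|exact HN]. }
  assert (hg : h = g).
  { apply functional_extensionality. intros x.
    destruct (kernel_diag H x) as [K0 K1]. set (kx := Re (k x x)) in *.
    apply (clim_unique eventually (fun n => kernel_comb k (s n) x)).
    - intros e He. destruct (inv_small (e * e / (kx + 1))) as [N HN].
      { apply Rdiv_lt_0_compat; nra. }
      exists N. intros n Hn. specialize (HN n Hn).
      set (d := (h x - kernel_comb k (s n) x)%C). rewrite Cmod_minus_sym. fold d.
      (* With this t the perturbation of s n by t d k(., x) gains at least t |d|^2,
         which cannot exceed the defect of the near-maximizer s n. *)
      set (t := / (kx + 1)).
      assert (T0 : 0 < t) by (apply Rinv_0_lt_compat; lra).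
      assert (T1 : t * (kx + 1) = 1) by (unfold t; field; lra).
      assert (A := JS ((RtoC t * d, x)%C :: s n)).
      assert (E : J ((RtoC t * d, x)%C :: s n) = J (s n) + (2 * t - t * t * kx) * Cmod d ^ 2).
      { unfold J.
        change (kernel_comb k ((RtoC t * d, x)%C :: s n)) with (fun y => (fun y => RtoC t * d * k y x)%C y + kernel_comb k (s n) y)%C.
        rewrite norm_sq_plus; [|apply (carrier_scal k H _ (fun y => k y x)), kernel_in|apply CC].
        rewrite (norm_sq_scal H (RtoC t * d)%C (fun y => k y x)) by apply kernel_in.
        rewrite (inner_scal k H _ (fun y => k y x)) by (auto; apply kernel_in).
        rewrite inner_conj, reproducing by (auto; apply kernel_in).
        unfold norm_sq at 1. rewrite reproducing by apply kernel_in. fold kx.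
        unfold L at 1. simpl csum.
        replace (Re (RtoC t * d * Cconj (h x) + csum (fun p => fst p * Cconj (h (snd p))) (s n))%C)
          with (L (s n) + Re (RtoC t * d * Cconj (h x))%C) by (unfold L, Re; simpl; ring).
        assert (D : Re (RtoC t * d * Cconj (h x))%C - Re (RtoC t * d * Cconj (kernel_comb k (s n) x))%C = t * Cmod d ^ 2).
        { transitivity (Re (RtoC t * RtoC (Cmod d ^ 2))%C); [|simpl; unfold Re; ring].
          rewrite Cmod2_conj. replace (Cconj d) with (Cconj (h x) - Cconj (kernel_comb k (s n) x))%C
            by (unfold d; now rewrite Cminus_conj). unfold Re. simpl. ring. }
        rewrite Cmod_mult, Cmod_R, (Rabs_pos_eq t) by lra.
        replace ((t * Cmod d) ^ 2) with (t * t * Cmod d ^ 2) by ring. lra. }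
      specialize (Hs n).
      assert (D2 : t * Cmod d ^ 2 < / (INR n + 1)).
      { assert (t * Cmod d ^ 2 <= (2 * t - t * t * kx) * Cmod d ^ 2); [|lra].
        apply Rmult_le_compat_r; [apply pow2_ge_0|]. nra. }
      assert (D3 : t * Cmod d ^ 2 < t * (e * e)).
      { eapply Rlt_trans; [exact D2|]. unfold t. unfold Rdiv in HN. lra. }
      apply Rmult_lt_reg_l in D3; [|exact T0].
      pose proof (Cmod_ge_0 d). nra.
    - intros e He.
      assert (Q : 0 < sqrt kx + 1) by (pose proof (sqrt_pos kx); lra).
      destruct (Lg' (e / (sqrt kx + 1))) as [N HN]; [now apply Rdiv_lt_0_compat|].
      exists N. intros n Hn. specialize (HN n Hn).
      eapply Rle_lt_trans.
      { apply (point_bound H (fun x => kernel_comb k (s n) x - g x)%C x). now apply carrier_minus. }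
      fold kx. pose proof (hnorm_ge_0 H (fun x => kernel_comb k (s n) x - g x)%C). pose proof (sqrt_pos kx).
      apply Rle_lt_trans with (hnorm H (fun x => kernel_comb k (s n) x - g x)%C * (sqrt kx + 1)); [nra|].
      apply Rlt_le_trans with (e / (sqrt kx + 1) * (sqrt kx + 1)); [now apply Rmult_lt_compat_r|].
      right. field. lra. }
  subst g. split; [exact Hg|split].
  - apply Rnot_lt_le. intros N. set (e := norm_sq H h - B) in *.
    assert (E0 : 0 < e) by (unfold e; lra).
    destruct (Lg' (sqrt e)) as [n Hn]; [now apply sqrt_lt_R0|]. specialize (Hn n (le_n n)).
    assert (M : norm_sq H (fun x => kernel_comb k (s n) x - h x)%C < e).
    { rewrite <- hnorm_sq by now apply carrier_minus.
      rewrite <- (sqrt_sqrt e) by lra.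
      apply Rmult_le_0_lt_compat; auto; apply hnorm_ge_0. }
    rewrite norm_sq_minus, kernel_comb_inner in M by auto.
    assert (A := HB (s n)). unfold e in M. lra.
  - now exists s.
Qed.

Lemma kernel_comb_dense {X} {k : X -> X -> C} (H : RKHS k) f : carrier H f ->
  exists s : nat -> list (C * X), forall eps, 0 < eps ->
    eventually (fun n => hnorm H (fun x => kernel_comb k (s n) x - f x)%C < eps).
Proof.
  intros Hf. apply (membership H f (norm_sq H f)). intros l.
  assert (P := inner_nonneg k H _ (carrier_minus H _ f (kernel_comb_carrier H l) Hf)).
  change (0 <= norm_sq H (fun x => kernel_comb k l x - f x)%C) in P.
  rewrite norm_sq_minus, kernel_comb_inner in P by (auto; apply kernel_comb_carrier). lra.
Qed.

(** The quadratic form is |f|^2 |v|^2 - |<v,f>|^2 for the combination v of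
    kernels. *)
Lemma kernel_dominates {X} {k : X -> X -> C} (H : RKHS k) f : carrier H f ->
  psd (fun x y => RtoC (hnorm H f * hnorm H f) * k x y - f x * Cconj (f y))%C.
Proof.
  intros Hf l.
  rewrite (quad_ext _ (fun x y => RtoC (hnorm H f * hnorm H f) * k x y + RtoC (-1) * (f x * Cconj (f y)))%C)
    by (intros; ring).
  rewrite quad_plus, !quad_scal, quad_rank_one, <- kernel_comb_inner with (H := H) by exact Hf.
  assert (E := norm_sq_comb H l). rewrite <- hnorm_sq in E by apply kernel_comb_carrier.
  assert (CS := cauchy_schwarz H _ f (kernel_comb_carrier H l) Hf).
  set (z := inner H (kernel_comb k l) f) in *.
  transitivity (hnorm H f * hnorm H f * Re (quad k l) - Cmod z ^ 2).
  - rewrite <- E. pose proof (Cmod_ge_0 z). pose proof (hnorm_ge_0 H f). pose proof (hnorm_ge_0 H (kernel_comb k l)). nra.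
  - right. unfold Re. simpl. ring.
Qed.

(** The hypothesis says that the formal adjoint, which sends k(., x) to
    conj(f(x)) k(., b x), has norm at most M on the span of the kernels.
    Hence the functional of x |-> f x * g (b x) at v is at most M |v| |g| and
    [membership] applies. *)
Lemma weighted_composition_bound {X} {k : X -> X -> C} (H : RKHS k) (f : X -> C) (b : X -> X) (M : R) :
  0 <= M ->
  psd (fun x y => RtoC (M * M) * k x y - f x * Cconj (f y) * k (b x) (b y))%C ->
  forall g, carrier H g ->
    carrier H (fun x => f x * g (b x))%C /\ hnorm H (fun x => f x * g (b x))%C <= M * hnorm H g.
Proof.
  intros HM P g Hg.
  assert (N : 0 <= M * hnorm H g) by (apply Rmult_le_pos; [exact HM|apply hnorm_ge_0]).
  destruct (membership H (fun x => f x * g (b x))%C ((M * hnorm H g) * (M * hnorm H g))) as [h1 [h2 _]].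
  - intros l. set (l' := map (fun p => ((fst p * Cconj (f (snd p)))%C, b (snd p))) l).
    assert (E : csum (fun p => fst p * Cconj (f (snd p) * g (b (snd p))))%C l = inner H (kernel_comb k l') g).
    { rewrite kernel_comb_inner by exact Hg. unfold l'. rewrite csum_map. apply csum_ext. intros p _. simpl.
      rewrite Cmult_conj. ring. }
    rewrite E.
    assert (Q : norm_sq H (kernel_comb k l') <= M * M * norm_sq H (kernel_comb k l)).
    { rewrite !norm_sq_comb. specialize (P l).
      rewrite (quad_ext _ (fun x y => RtoC (M * M) * k x y + RtoC (-1) * (f x * Cconj (f y) * k (b x) (b y)))%C) in P
        by (intros; ring).
      rewrite quad_plus, !quad_scal, (quad_twist f (fun x y => k (b x) (b y))), (quad_pull b k), map_map in P.
      change (map _ l) with l' in P.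
      assert (R : Re (RtoC (M * M) * quad k l + RtoC (-1) * quad k l')%C = M * M * Re (quad k l) - Re (quad k l'))
        by (unfold Re; simpl; ring).
      rewrite R in P. lra. }
    rewrite <- (hnorm_sq H (kernel_comb k l')), <- (hnorm_sq H (kernel_comb k l)) in Q by apply kernel_comb_carrier.
    rewrite <- (hnorm_sq H (kernel_comb k l)) by apply kernel_comb_carrier.
    pose proof (hnorm_ge_0 H (kernel_comb k l)) as A1. pose proof (hnorm_ge_0 H (kernel_comb k l')) as A2.
    assert (A : hnorm H (kernel_comb k l') <= M * hnorm H (kernel_comb k l)).
    { apply Rsqr_incr_0_var; [unfold Rsqr; lra|now apply Rmult_le_pos]. }
    assert (CS := cauchy_schwarz H _ g (kernel_comb_carrier H l') Hg).
    pose proof (Re_le_Cmod (inner H (kernel_comb k l') g)).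
    pose proof (hnorm_ge_0 H g).
    assert (hnorm H (kernel_comb k l') * hnorm H g <= M * hnorm H (kernel_comb k l) * hnorm H g) by now apply Rmult_le_compat_r.
    pose proof (pow2_ge_0 (hnorm H (kernel_comb k l) - M * hnorm H g)). nra.
  - split; [exact h1|]. rewrite <- hnorm_sq in h2 by exact h1.
    apply Rsqr_incr_0_var; [exact h2|exact N].
Qed.

(** * Kernels on the disk *)

Lemma disk_lt (z : disk) : Cmod z < 1.
Proof. exact (proj2_sig z). Qed.

Lemma disk_one_minus_neq (z w : disk) : (1 - z * Cconj w)%C <> 0.
Proof. apply one_minus_neq, Cmod_prod_conj_lt_1; apply disk_lt. Qed.

Lemma at_left_gt a : a < 1 -> at_left 1 (fun r => a < r).
Proof.
  intros H. exists (mkposreal (1 - a) ltac:(lra)). intros y Hy _.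
  change (Rabs (y - 1) < 1 - a) in Hy. apply Rabs_lt_between in Hy. lra.
Qed.

Lemma szego_clim (x y : disk) :
  clim (at_left 1) (fun r => szego r y x) (/ (1 - x * Cconj y))%C.
Proof.
  assert (L : clim (at_left 1) RtoC 1).
  { intros e He. generalize (clim_id_R 1 e He). unfold at_left, within. apply filter_imp. auto. }
  assert (N1 : (RtoC 1 * RtoC 1)%C <> 0) by (rewrite Cmult_1_l; apply C1_nz).
  assert (Q : clim (at_left 1) (fun r => x * Cconj y / RtoC (r * r))%C (x * Cconj y / (RtoC 1 * RtoC 1))%C).
  { apply (clim_div (at_left 1)); [exact N1|apply (clim_const (at_left 1))|].
    apply (clim_ext (at_left 1) (fun r => RtoC r * RtoC r)%C); [intros; now rewrite RtoC_mult|].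
    now apply (clim_mult (at_left 1)). }
  replace (x * Cconj y / (RtoC 1 * RtoC 1))%C with (x * Cconj y)%C in Q by (field; exact C1_nz).
  unfold szego. apply (clim_inv (at_left 1)); [apply disk_one_minus_neq|].
  apply (clim_minus (at_left 1)); [apply (clim_const (at_left 1))|exact Q].
Qed.

(** The Szego kernels of the disks of radius r tend to that of the unit
    disk. *)
Lemma pick_exhaustion (phi : disk -> C) (M : R) :
  (forall r (l : list (C * disk)), 0 < r < 1 -> (forall p, In p l -> Cmod (snd p) < r) ->
     0 <= Re (quad (fun z w : disk => (RtoC (M * M) - phi z * Cconj (phi w)) * szego r w z)%C l)) ->
  psd (fun z w : disk => (RtoC (M * M) - phi z * Cconj (phi w)) / (1 - z * Cconj w))%C.
Proof.
  intros H.
  apply (psd_lim (at_left 1) (fun r (z w : disk) => (RtoC (M * M) - phi z * Cconj (phi w)) * szego r w z)%C).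
  - intros x y. apply (clim_mult (at_left 1)); [apply (clim_const (at_left 1))|apply szego_clim].
  - intros l.
    assert (E : at_left 1 (fun r => forall p, In p l -> Cmod (snd p) < r)).
    { clear H. induction l as [|p l IH].
      - apply (filter_forall (F := at_left 1)). intros r q [].
      - generalize (filter_and (F := at_left 1) _ _ (at_left_gt _ (disk_lt (snd p))) IH).
        apply filter_imp. intros r [h1 h2] q [<-|Hq]; auto. }
    assert (E' : at_left 1 (fun r => r < 1)) by (exists (mkposreal 1 Rlt_0_1); auto).
    generalize (filter_and (F := at_left 1) _ _ (filter_and (F := at_left 1) _ _ E E') (at_left_gt 0 Rlt_0_1)).
    apply filter_imp. intros r [[h1 h2] h3]. apply H; auto.
Qed.

Lemma pick_disk (F : C -> C) (M : R) : 0 <= M ->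
  (forall z, Cmod z < 1 -> cdiff F z) -> (forall z, Cmod z < 1 -> Cmod (F z) <= M) ->
  psd (fun z w : disk => (RtoC (M * M) - F z * Cconj (F w)) / (1 - z * Cconj w))%C.
Proof.
  intros HM Hd Hb. apply (pick_exhaustion (fun z => F z)). intros r l Hr Hl.
  rewrite (quad_pull disk_val (fun z w => (RtoC (M * M) - F z * Cconj (F w)) * szego r w z)%C).
  apply pick_circle; try lra.
  - intros z Hz. apply Hd. lra.
  - intros z Hz. apply Hb. lra.
  - intros p Hp. apply in_map_iff in Hp. destruct Hp as [q [<- Hq]]. now apply Hl.
Qed.

Lemma clim_at_right_square s : clim (at_right s) (fun t => RtoC (t * t)) (RtoC (s * s)).
Proof.
  assert (L : clim (at_right s) RtoC s).
  { intros e He. generalize (clim_id_R s e He). unfold at_right, within. apply filter_imp. auto. }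
  rewrite RtoC_mult. apply (clim_ext (at_right s) (fun r => RtoC r * RtoC r)%C); [intros; now rewrite RtoC_mult|].
  now apply (clim_mult (at_right s)).
Qed.

Lemma bergman_diag alpha (z : disk) : Re (bergman_kernel alpha z z) = / (1 - Cmod z ^ 2) ^ alpha.
Proof.
  unfold bergman_kernel. rewrite <- Cmod2_conj, <- RtoC_minus, <- RtoC_pow.
  assert (P : 0 < (1 - Cmod z ^ 2) ^ alpha).
  { apply pow_lt. pose proof (disk_lt z). pose proof (Cmod_ge_0 z). nra. }
  rewrite <- RtoC_div by lra. simpl. unfold Rdiv. ring.
Qed.

(** f is the limit of combinations of kernels, uniformly on each disk of
    radius r < 1.  These combinations are explicit holomorphic functions, and
    for t > s their reciprocals are eventually bounded by t on that disk, so
    [pick_circle] applies to them.  Then let n tend to infinity, r to 1 and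
    t to s. *)
Lemma pick_reciprocal alpha (A2 : RKHS (bergman_kernel alpha)) f s :
  carrier A2 f -> (forall z, f z <> 0) -> (forall z, Cmod (/ f z)%C <= s) ->
  psd (fun z w : disk => (RtoC (s * s) - / f z * Cconj (/ f w)) / (1 - z * Cconj w))%C.
Proof.
  intros Hf Nf Hs.
  assert (S0 : 0 < s).
  { eapply Rlt_le_trans; [|apply (Hs disk0)]. rewrite Cmod_inv by auto.
    apply Rinv_0_lt_compat, Cmod_gt_0, Nf. }
  destruct (kernel_comb_dense A2 f Hf) as [sq Hsq].
  set (V := fun n (z : C) => csum (fun p : C * disk => fst p * (1 / (1 - z * Cconj (snd p)) ^ alpha))%C (sq n)).
  assert (VE : forall n (z : disk), V n z = kernel_comb (bergman_kernel alpha) (sq n) z) by reflexivity.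
  assert (Vd : forall n z, Cmod z < 1 -> cdiff (V n) z).
  { intros n z Hz. apply csum_cdiff. intros p _. apply cdiff_mult; [apply cdiff_const|].
    apply cdiff_mult; [apply cdiff_const|]. apply cdiff_inv.
    - apply Cpow_nz, one_minus_neq, Cmod_prod_conj_lt_1; [exact Hz|apply disk_lt].
    - apply cdiff_pow, cdiff_minus; [apply cdiff_const|].
      apply cdiff_mult; [apply cdiff_id|apply cdiff_const]. }
  assert (Vu : forall r e, 0 < r < 1 -> 0 < e ->
     eventually (fun n => forall z : disk, Cmod z <= r -> Cmod (V n z - f z)%C < e)).
  { intros r e Hr He. set (kr := / (1 - r ^ 2) ^ alpha).
    assert (P : 0 < 1 - r ^ 2) by nra.
    pose proof (sqrt_pos kr) as Q.
    assert (E : 0 < e / (sqrt kr + 1)) by (apply Rdiv_lt_0_compat; lra).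
    generalize (Hsq _ E). apply filter_imp. intros n Hn z Hz. rewrite VE.
    eapply Rle_lt_trans.
    { apply (point_bound A2 (fun x => kernel_comb (bergman_kernel alpha) (sq n) x - f x)%C z).
      apply carrier_minus; [apply kernel_comb_carrier|exact Hf]. }
    set (N := hnorm A2 _) in *. assert (0 <= N) by apply hnorm_ge_0.
    assert (D : sqrt (Re (bergman_kernel alpha z z)) <= sqrt kr).
    { apply sqrt_le_1_alt. rewrite bergman_diag. unfold kr. pose proof (Cmod_ge_0 z).
      apply Rinv_le_contravar; [now apply pow_lt|]. apply pow_incr. split; [lra|]. nra. }
    apply Rle_lt_trans with (N * (sqrt kr + 1)); [apply Rmult_le_compat_l; lra|].
    apply Rlt_le_trans with (e / (sqrt kr + 1) * (sqrt kr + 1)); [apply Rmult_lt_compat_r; lra|].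
    right. field. lra. }
  assert (main : forall t, s < t ->
     psd (fun z w : disk => (RtoC (t * t) - / f z * Cconj (/ f w)) / (1 - z * Cconj w))%C).
  { intros t Ht. apply (pick_exhaustion (fun z => / f z)%C). intros r l Hr Hl.
    apply (clim_Re_ge_0 eventually
      (fun n => quad (fun z w : disk => (RtoC (t * t) - / V n z * Cconj (/ V n w)) * szego r w z)%C l)).
    - apply (quad_clim eventually (fun n (z w : disk) => (RtoC (t * t) - / V n z * Cconj (/ V n w)) * szego r w z)%C).
      intros x y Hx Hy.
      assert (cv : forall q, In q (map snd l) -> clim eventually (fun n => / V n (disk_val q))%C (/ f q)%C).
      { intros q Hq. apply (clim_inv eventually); [apply Nf|]. intros e He.
        generalize (Vu r e Hr He). apply filter_imp. intros n h. apply h.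
        apply in_map_iff in Hq. destruct Hq as [p [<- Hp]]. left. now apply Hl. }
      apply (clim_mult eventually); [|apply (clim_const eventually)].
      apply (clim_minus eventually); [apply (clim_const eventually)|].
      apply (clim_mult eventually); [|apply (clim_conj eventually)]; auto.
    - assert (It : / t < / s) by (apply Rinv_lt_contravar; nra).
      assert (It0 : 0 < / t) by (apply Rinv_0_lt_compat; lra).
      generalize (Vu r (/ s - / t) Hr ltac:(lra)). apply filter_imp. intros n Hn.
      assert (low : forall z, Cmod z <= r -> / t <= Cmod (V n z)).
      { intros z Hz. assert (Hz1 : Cmod z < 1) by lra.
        set (zd := exist _ z Hz1 : disk).
        specialize (Hn zd Hz). specialize (Hs zd). specialize (Nf zd).
        change (disk_val zd) with z in Hn.
        rewrite Cmod_minus_sym in Hn. pose proof (Cmod_minus_lower (f zd) (V n z)).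
        rewrite Cmod_inv in Hs by auto.
        assert (0 < Cmod (f zd)) by now apply Cmod_gt_0.
        assert (/ s <= / / Cmod (f zd)) by (apply Rinv_le_contravar; [now apply Rinv_0_lt_compat|exact Hs]).
        rewrite Rinv_inv in H1. lra. }
      rewrite (quad_pull disk_val (fun z w => (RtoC (t * t) - / V n z * Cconj (/ V n w)) * szego r w z)%C).
      assert (nz : forall z, Cmod z <= r -> V n z <> 0) by (intros z Hz; apply Cmod_gt_0; specialize (low z Hz); lra).
      apply (pick_circle (fun z => / V n z)%C); try lra.
      + intros z Hz. apply cdiff_inv; [now apply nz|apply Vd; lra].
      + intros z Hz. rewrite Cmod_inv by now apply nz.
        rewrite <- (Rinv_inv t). apply Rinv_le_contravar; [exact It0|now apply low].
      + intros p Hp. apply in_map_iff in Hp. destruct Hp as [q [<- Hq]]. now apply Hl. }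
  apply (psd_lim (at_right s) (fun t (z w : disk) => (RtoC (t * t) - / f z * Cconj (/ f w)) / (1 - z * Cconj w))%C).
  - intros x y. apply (clim_mult (at_right s)); [|apply (clim_const (at_right s))].
    apply (clim_minus (at_right s)); [apply clim_at_right_square|apply (clim_const (at_right s))].
  - intros l. exists (mkposreal 1 Rlt_0_1). intros t _ Ht. now apply main.
Qed.

(** Up to the factor d, this is the quadratic form of K at l extended by the
    point x0, with the coefficient at x0 that minimizes it.  For the kernel of
    a function space this is [kernel_dominates] applied to the function
    K(., x0); the present form applies before a space with kernel K is known
    to exist. *)
Lemma psd_schur_complement {X} (K : X -> X -> C) (x0 : X) (d : R) :
  psd K -> (forall x y, K y x = Cconj (K x y)) -> K x0 x0 = RtoC d -> 0 < d ->
  psd (fun x y => RtoC d * K x y - K x x0 * Cconj (K y x0))%C.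
Proof.
  intros P Hh Hd D l.
  set (A := csum (fun q => fst q * Cconj (K (snd q) x0))%C l).
  assert (E : quad (fun x y => RtoC d * K x y - K x x0 * Cconj (K y x0))%C l = (RtoC d * quad K l - RtoC (Cmod A ^ 2))%C).
  { rewrite (quad_ext _ (fun x y => RtoC d * K x y + RtoC (-1) * (K x x0 * Cconj (K y x0)))%C) by (intros; ring).
    rewrite quad_plus, !quad_scal, (quad_rank_one (fun x => K x x0)). fold A. ring. }
  rewrite E.
  assert (D0 : RtoC d <> 0) by (intros Z; apply RtoC_inj in Z; lra).
  set (c := (- A / RtoC d)%C).
  assert (Q : quad K ((c, x0) :: l) = (quad K l - RtoC (Cmod A ^ 2) / RtoC d)%C).
  { change (quad K ((c, x0) :: l)) with
      (Cconj c * (c * K x0 x0 + csum (fun q => fst q * K x0 (snd q)) l)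
       + csum (fun p => Cconj (fst p) * (c * K (snd p) x0 + csum (fun q => fst q * K (snd p) (snd q)) l)) l)%C.
    unfold quad.
    rewrite (csum_ext (fun p => Cconj (fst p) * (c * K (snd p) x0 + csum (fun q => fst q * K (snd p) (snd q)) l))%C
       (fun p => c * Cconj (fst p * Cconj (K (snd p) x0)) + Cconj (fst p) * csum (fun q => fst q * K (snd p) (snd q)) l)%C).
    2:{ intros p _. rewrite Cmult_conj, Cconj_conj. ring. }
    rewrite csum_plus, csum_scal, <- csum_conj. fold A.
    rewrite (csum_ext (fun q => fst q * K x0 (snd q))%C (fun q => fst q * Cconj (K (snd q) x0))%C).
    2:{ intros q _. now rewrite <- Hh. }
    fold A. rewrite Hd. rewrite Cmod2_conj. unfold c.
    replace (- A / RtoC d * RtoC d + A)%C with (RtoC 0) by (field; exact D0).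
    field. exact D0. }
  specialize (P ((c, x0) :: l)). rewrite Q in P.
  rewrite <- RtoC_div in P by lra.
  change (0 <= Re (quad K l) - Cmod A ^ 2 / d) in P.
  replace (Re (RtoC d * quad K l - RtoC (Cmod A ^ 2))%C) with (d * (Re (quad K l) - Cmod A ^ 2 / d))
    by (unfold Re; simpl; field; lra).
  apply Rmult_le_pos; lra.
Qed.

Lemma psd_schwarz_pick (b : disk -> disk) :
  analytic_on_disk (fun z => disk_val (b z)) ->
  psd (fun z w : disk => (1 - b z * Cconj (b w)) / (1 - z * Cconj w))%C.
Proof.
  intros [F [HF HD]].
  assert (P := pick_disk F 1 ltac:(lra)).
  assert (D : psd (fun z w : disk => ((1 * 1)%R - F z * Cconj (F w)) / (1 - z * Cconj w))%C).
  { apply P.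
    - intros z Hz. apply cdiff_of_ex_derive. exact (HD (exist _ z Hz)).
    - intros z Hz. change z with (disk_val (exist _ z Hz)). rewrite HF. left. apply disk_lt. }
  revert D. apply psd_ext. intros x y. now rewrite !HF, Rmult_1_r.
Qed.

(** Put a = b(0), d = 1 - |a|^2 and s = 1/(1 - |a|).  The Schur complement at
    0 of the kernel of [psd_schwarz_pick] gives d (1 - b b~)/(1 - z w~) >= f
    f~ with f = 1 - b conj(a); dividing by 1 - b b~ gives d/(1 - z w~) >=
    f f~/(1 - b b~).  Since 1/f is bounded by s as a function of b, also s^2
    f f~/(1 - b b~) >= 1/(1 - b b~).  Finally s^2 d is the constant of the
    statement. *)
Lemma psd_composition_gap (b : disk -> disk) :
  analytic_on_disk (fun z => disk_val (b z)) ->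
  psd (fun z w : disk => RtoC ((1 + Cmod (b disk0)) / (1 - Cmod (b disk0))) / (1 - z * Cconj w)
         - 1 / (1 - b z * Cconj (b w)))%C.
Proof.
  intros Hb. set (a := disk_val (b disk0)). set (m := Cmod a).
  assert (m1 : m < 1) by apply disk_lt. assert (m0 : 0 <= m) by apply Cmod_ge_0.
  assert (Ka : forall z : C, Cmod z < 1 -> (1 - z * Cconj a)%C <> 0)
    by (intros z Hz; apply one_minus_neq, Cmod_prod_conj_lt_1; auto).
  set (d := 1 - m ^ 2).
  assert (Hd : 0 < d) by (unfold d; nra).
  set (f := fun z : disk => (1 - b z * Cconj a)%C).
  assert (P1 := psd_schur_complement _ disk0 d (psd_schwarz_pick b Hb)).
  assert (P2 : psd (fun x y : disk => RtoC d * ((1 - b x * Cconj (b y)) / (1 - x * Cconj y)) - f x * Cconj (f y))%C).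
  { assert (Z : forall x : disk, (1 - x * Cconj disk0)%C = 1).
    { intros x. change (disk_val disk0) with (RtoC 0). rewrite Cconj_RtoC. ring. }
    assert (G : forall x : disk, ((1 - b x * Cconj (b disk0)) / (1 - x * Cconj disk0))%C = f x).
    { intros x. rewrite Z. unfold f, a. field. }
    eapply psd_ext; [|apply P1].
    - intros x y. simpl. now rewrite !G.
    - intros x y. rewrite Cdiv_conj by apply disk_one_minus_neq.
      rewrite !Cminus_conj, !Cmult_conj, !Cconj_conj, Cconj_RtoC. f_equal; [|f_equal]; ring.
    - rewrite G. unfold f. fold a. rewrite <- Cmod2_conj, <- RtoC_minus. reflexivity.
    - exact Hd. }
  apply (psd_geometric (fun x => disk_val (b x))) in P2; [|intros; apply disk_lt].
  set (s := / (1 - m)).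
  assert (s0 : 0 < s) by (apply Rinv_0_lt_compat; lra).
  assert (P3 : psd (fun z w : disk => (RtoC (s * s) - / (1 - z * Cconj a) * Cconj (/ (1 - w * Cconj a))) / (1 - z * Cconj w))%C).
  { apply (pick_disk (fun z => / (1 - z * Cconj a))%C); [lra| |].
    - intros z Hz. apply cdiff_inv; [now apply Ka|].
      apply cdiff_minus; [apply cdiff_const|apply cdiff_mult; [apply cdiff_id|apply cdiff_const]].
    - intros z Hz. rewrite Cmod_inv by now apply Ka.
      apply Rinv_le_contravar; [lra|].
      eapply Rle_trans; [|apply Cmod_minus_lower]. rewrite Cmod_1, Cmod_mult, Cmod_conj. fold m.
      pose proof (Cmod_ge_0 z). nra. }
  apply (psd_pull b) in P3. apply (psd_twist f) in P3.
  apply (psd_scal (s * s)) in P2; [|nra].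
  generalize (psd_plus _ _ P2 P3). apply psd_ext. intros x y. cbv beta.
  assert (fx : forall z, f z <> 0) by (intros z; apply Ka, disk_lt).
  change (1 - b x * Cconj a)%C with (f x). change (1 - b y * Cconj a)%C with (f y).
  rewrite Cinv_conj by auto.
  assert (fy : Cconj (f y) <> 0).
  { apply Cmod_gt_0. rewrite Cmod_conj. now apply Cmod_gt_0. }
  assert (R1 : (1 + m) / (1 - m) = s * s * d) by (unfold s, d; field; lra).
  rewrite R1, !RtoC_mult. field.
  repeat split; auto; apply disk_one_minus_neq.
Qed.

(** With X = c/(1 - z w~) and Y = 1/(1 - b b~), X^(n+1) - Y^(n+1) =
    X (X^n - Y^n) + (X - Y) Y^n, and both terms are positive by the geometric
    series. *)
Lemma psd_composition_gap_pow (b : disk -> disk) (n : nat) :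
  analytic_on_disk (fun z => disk_val (b z)) ->
  psd (fun z w : disk => RtoC (((1 + Cmod (b disk0)) / (1 - Cmod (b disk0))) ^ n) * bergman_kernel n z w
         - bergman_kernel n (b z) (b w))%C.
Proof.
  intros Hb. assert (G := psd_composition_gap b Hb).
  set (c := (1 + Cmod (b disk0)) / (1 - Cmod (b disk0))) in *.
  assert (c0 : 0 <= c).
  { unfold c. pose proof (disk_lt (b disk0)). pose proof (Cmod_ge_0 (b disk0)).
    apply Rmult_le_pos; [lra|left; apply Rinv_0_lt_compat; lra]. }
  induction n as [|n IH].
  - intros l. rewrite (quad_ext _ (fun x y => RtoC 0 * 0)%C).
    + rewrite (quad_scal 0 (fun x y : disk => 0%C)), Cmult_0_l. simpl. lra.
    + intros x y _ _. unfold bergman_kernel. simpl. field.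
  - apply (psd_geometric disk_val) in IH; [|apply disk_lt].
    apply (psd_scal c _ c0) in IH.
    apply (psd_geometric_pow (fun x => disk_val (b x)) _ n) in G; [|intros; apply disk_lt].
    generalize (psd_plus _ _ IH G). apply psd_ext. intros x y.
    unfold bergman_kernel. rewrite !Cpow_S. simpl pow. rewrite RtoC_mult.
    field. repeat split; try apply Cpow_nz; apply disk_one_minus_neq.
Qed.

(** * Operators on the Bergman space *)

Lemma op_norm_le {X} {k : X -> X -> C} (H : RKHS k) T M : 0 <= M ->
  (forall g, carrier H g -> hnorm H (T g) <= M * hnorm H g) ->
  Rbar_le (op_norm H T) (Finite M).
Proof.
  intros HM HT. apply Lub_Rbar_correct. intros r [g [Hg [Ng ->]]]. simpl.
  eapply Rle_trans; [now apply HT|]. nra.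
Qed.

Lemma bounded_and_norm_le {X} {k : X -> X -> C} (H : RKHS k) T M : 0 <= M ->
  (forall g, carrier H g -> carrier H (T g) /\ hnorm H (T g) <= M * hnorm H g) ->
  bounded_on H T /\ Rbar_le (op_norm H T) (Finite M).
Proof.
  intros HM HT. split.
  - split; [intros g Hg; now apply HT|]. exists M. intros g Hg. now apply HT.
  - apply op_norm_le; [exact HM|]. intros g Hg. now apply HT.
Qed.

Lemma Cpow_div (x y : C) n : y <> 0 -> ((x / y) ^ n)%C = (x ^ n / y ^ n)%C.
Proof. intros Hy. unfold Cdiv. now rewrite Cpow_mult_l, Cpow_inv. Qed.

(** Dividing the positive kernel |f|^2 k^b - f f~ by (1 - b b~)^alpha produces
    the kernel required by [weighted_composition_bound]. *)
Lemma weighted_composition_on_bergman alpha (b : disk -> disk)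
    (A2 : RKHS (bergman_kernel alpha)) (Ab : RKHS (sub_bergman_kernel b alpha)) f :
  carrier Ab f -> forall g, carrier A2 g ->
  carrier A2 (mult_op f (comp_op b g)) /\
  hnorm A2 (mult_op f (comp_op b g)) <= hnorm Ab f * hnorm A2 g.
Proof.
  intros Hf. apply (weighted_composition_bound A2 f b); [apply hnorm_ge_0|].
  assert (P := kernel_dominates Ab f Hf).
  apply (psd_geometric_pow (fun x => disk_val (b x)) _ alpha) in P; [|intros; apply disk_lt].
  revert P. apply psd_ext. intros x y. unfold bergman_kernel, sub_bergman_kernel.
  pose proof (disk_one_minus_neq x y). pose proof (disk_one_minus_neq (b x) (b y)).
  rewrite Cpow_div by auto.
  field. split; now apply Cpow_nz.
Qed.

(** The constant 1 is the kernel at the point 0. *)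
Lemma one_in_bergman alpha (A2 : RKHS (bergman_kernel alpha)) : carrier A2 (fun _ => RtoC 1).
Proof.
  assert (H := kernel_in _ A2 disk0). revert H.
  replace (fun z => bergman_kernel alpha z disk0) with (fun _ : disk => RtoC 1); [auto|].
  apply functional_extensionality. intros z. unfold bergman_kernel.
  change (disk_val disk0) with (RtoC 0). rewrite Cconj_RtoC.
  replace (1 - z * 0)%C with (RtoC 1) by ring. rewrite Cpow_1_l. field.
Qed.

(** [pick_reciprocal] provides one factor 1/(1 - z w~) of the kernel, the
    geometric series the remaining alpha - 1. *)
Lemma reciprocal_multiplier alpha (A2 : RKHS (bergman_kernel alpha)) f s :
  (1 <= alpha)%nat ->
  carrier A2 f -> (forall z, f z <> 0) -> (forall z, Cmod (/ f z)%C <= s) ->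
  forall g, carrier A2 g ->
  carrier A2 (fun z => / f z * g z)%C /\ hnorm A2 (fun z => / f z * g z)%C <= s * hnorm A2 g.
Proof.
  intros Ha Hf Nf Hs.
  assert (S0 : 0 <= s) by (eapply Rle_trans; [apply Cmod_ge_0|apply (Hs disk0)]).
  apply (weighted_composition_bound A2 (fun z => / f z)%C (fun z => z)); [exact S0|].
  assert (P := pick_reciprocal alpha A2 f s Hf Nf Hs).
  destruct alpha as [|n]; [lia|].
  apply (psd_geometric_pow disk_val _ n) in P; [|apply disk_lt].
  revert P. apply psd_ext. intros x y. unfold bergman_kernel. rewrite Cpow_S.
  rewrite Cinv_conj by auto.
  assert (Cconj (f y) <> 0) by (apply Cmod_gt_0; rewrite Cmod_conj; now apply Cmod_gt_0).
  field. repeat split; auto; try apply Cpow_nz; apply disk_one_minus_neq.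
Qed.

Lemma sup_inv_finite f s : sup_inv f = Finite s ->
  forall z, f z <> RtoC 0 /\ Cmod (/ f z)%C <= s.
Proof.
  intros E z. unfold sup_inv in E.
  match type of E with Rbar_lub ?P = _ => destruct (proj2_sig (Rbar_ex_lub P)) as [U _] end.
  unfold Rbar_lub in E. rewrite E in U.
  assert (N : f z <> 0).
  { intros Z. assert (L := U p_infty (ex_intro _ z (or_introl (conj Z eq_refl)))). exact L. }
  split; [exact N|].
  assert (L := U _ (ex_intro _ z (or_intror (conj N eq_refl)))). simpl in L.
  now replace (/ f z)%C with (1 / f z)%C by (unfold Cdiv; ring).
Qed.

Theorem mainTheorem4 :
  forall (alpha : nat) (b : disk -> disk)
    (halpha : (1 <= alpha)%nat)
    (hb_analytic : analytic_on_disk (fun z => disk_val (b z)))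
    (hb_nonconst : ~ exists c : C, forall z : disk, disk_val (b z) = c)
    (A2 : RKHS (bergman_kernel alpha)),
    (forall (Ab : RKHS (sub_bergman_kernel b alpha)) (f : disk -> C),
       carrier Ab f ->
       bounded_on A2 (fun g => mult_op f (comp_op b g)) /\
       Rbar_le (op_norm A2 (fun g => mult_op f (comp_op b g)))
               (Finite (hnorm Ab f)))
    /\
    (bounded_on A2 (comp_op b) /\
     Rbar_le (op_norm A2 (comp_op b))
             (Finite (Rpower ((1 + Cmod (b disk0)) / (1 - Cmod (b disk0)))
                             (INR alpha / 2))))
    /\
    (forall Ab : RKHS (sub_bergman_kernel b alpha),
       Rbar_le (op_norm A2 (comp_op b))
               (Rbar_glb (fun r : Rbar => exists f : disk -> C,
                  carrier Ab f /\ r = sup_inv_times f (hnorm Ab f)))).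
Proof.
  intros alpha b halpha hb _ A2. split; [|split].
  - intros Ab f Hf. apply bounded_and_norm_le; [apply hnorm_ge_0|].
    now apply weighted_composition_on_bergman.
  - set (c := (1 + Cmod (b disk0)) / (1 - Cmod (b disk0))).
    assert (c0 : 0 < c).
    { pose proof (disk_lt (b disk0)). pose proof (Cmod_ge_0 (b disk0)). apply Rdiv_lt_0_compat; lra. }
    set (M := Rpower c (INR alpha / 2)).
    assert (M0 : 0 <= M) by (left; apply exp_pos).
    assert (MM : M * M = c ^ alpha).
    { unfold M. rewrite <- Rpower_plus, <- Rpower_pow by exact c0. f_equal. field. }
    apply bounded_and_norm_le; [exact M0|]. intros g Hg.
    replace (comp_op b g) with (fun x : disk => RtoC 1 * g (b x))%C
      by (apply functional_extensionality; intros; apply Cmult_1_l).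
    apply (weighted_composition_bound A2 (fun _ => RtoC 1) b M M0); [|exact Hg].
    rewrite MM. generalize (psd_composition_gap_pow b alpha hb). apply psd_ext.
    intros x y. rewrite Cconj_RtoC. fold c. ring.
  - intros Ab. apply (proj2_sig (Rbar_ex_glb _)). intros r [f [Hf ->]].
    unfold sup_inv_times. destruct (sup_inv f) as [s| |] eqn:E;
      try (destruct (op_norm A2 (comp_op b)); exact I).
    assert (F := sup_inv_finite f s E).
    assert (S0 : 0 <= s) by (eapply Rle_trans; [apply Cmod_ge_0|apply (F disk0)]).
    assert (WC := weighted_composition_on_bergman alpha b A2 Ab f Hf).
    assert (Hf2 : carrier A2 f).
    { destruct (WC _ (one_in_bergman alpha A2)) as [h _].
      replace f with (mult_op f (comp_op b (fun _ => RtoC 1))); [exact h|].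
      apply functional_extensionality. intros z. apply Cmult_1_r. }
    apply op_norm_le; [apply Rmult_le_pos; [exact S0|apply hnorm_ge_0]|].
    intros g Hg. destruct (WC g Hg) as [h1 h2].
    destruct (reciprocal_multiplier alpha A2 f s halpha Hf2
       (fun z => proj1 (F z)) (fun z => proj2 (F z)) _ h1) as [_ h3].
    replace (comp_op b g) with (fun z => / f z * mult_op f (comp_op b g) z)%C.
    2:{ apply functional_extensionality. intros z. unfold mult_op. field. apply F. }
    eapply Rle_trans; [exact h3|]. rewrite Rmult_assoc. now apply Rmult_le_compat_l.
Qed.
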